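(* Let $T\in(0,\infty)$ and $\alpha>0$ be fixed, and let $(B_t)_{t\geq 0}$ be a one-dimensional standard Wiener process. The process $(Y_t^{(\alpha)})_{t\in[0,T]}$ defined by $$Y_t^{(\alpha)}:=\begin{cases}\displaystyle\int_0^t\left(\frac{T-t}{T-s}\right)^\alpha\mathrm{d}B_s & \text{if } t\in[0,T),\\ 0 & \text{if } t=T,\end{cases}$$ is a centered Gauss process with almost surely continuous paths.
   Context: For $t\in[0,T)$, the process $\int_0^t\left(\frac{T-t}{T-s}\right)^\alpha\mathrm{d}B_s=(T-t)^\alpha\int_0^t(T-s)^{-\alpha}\,\mathrm{d}B_s$ is taken in its continuous version on $[0,T)$ (the Itô integral process $t\mapsto\int_0^t(T-s)^{-\alpha}\,\mathrm{d}B_s$ is the usual continuous version). ''Gauss process'' means Gaussian process (possibly degenerate finite-dimensional normal distributions); ''centered'' means mean function identically zero. Almost sure continuity of the paths refers to the closed interval $[0,T]$. *)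

(* Defs.v *)
From HB Require Import structures.
From mathcomp Require Import all_boot all_order all_algebra.
From mathcomp Require Import all_classical all_reals all_analysis.

Set Implicit Arguments.
Unset Strict Implicit.
Unset Printing Implicit Defensive.

Import Order.TTheory GRing.Theory Num.Theory.
Import numFieldNormedType.Exports.

Local Open Scope classical_set_scope.
Local Open Scope ring_scope.

Section Gaussian.
Context {d : measure_display} {Omega : measurableType d} {R : realType}.
Variable P : probability Omega R.

(* The degenerate law is split off because [normal_prob m 0] is by convention
   the uniform law on [0, 1], not the point mass at [m]. *)
Definition normal_law (m s : R) (C : set R) : \bar R :=
  if s == 0 then \d_m C else normal_prob m s C.

(* [X] is normal with mean [m] and standard deviation [s].  Only measurable
   sets are tested: the measures involved carry no information elsewhere. *)
Definition has_normal_law (X : Omega -> R) (m s : R) : Prop :=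
  forall C : set R, measurable C -> P (X @^-1` C) = normal_law m s C.

(* A random vector is (possibly degenerate) multivariate normal when all
   linear combinations of its coordinates are (possibly degenerate) normal. *)
Definition gaussian_vector (n : nat) (X : 'I_n -> {RV P >-> R}) : Prop :=
  forall c : 'I_n -> R, exists m s : R,
    0 <= s /\ has_normal_law (fun w => \sum_(i < n) c i * X i w) m s.

Definition gaussian_process (D : set R) (X : R -> {RV P >-> R}) : Prop :=
  forall (n : nat) (t : 'I_n -> R), (forall i, D (t i)) ->
    gaussian_vector (fun i => X (t i)).

Definition centered_process (D : set R) (X : R -> {RV P >-> R}) : Prop :=
  forall t, D t -> ('E_P[X t] = 0)%E.

Definition ae_continuous_paths (D : set R) (X : R -> {RV P >-> R}) : Prop :=
  {ae P, forall w, {within D, continuous (fun t => X t w)}}.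

End Gaussian.

Section Wiener.
Context {d : measure_display} {Omega : measurableType d} {R : realType}.
Context {P : probability Omega R}.

(* Processes are indexed by all of [R]; the indices outside the time set of
   interest (here the negative ones) are never looked at. *)
Variable B : R -> {RV P >-> R}.

(* The natural filtration: the sigma-algebra generated by the [B u],
   [0 <= u <= s]. *)
Definition past (s : R) : set (set Omega) :=
  <<s [set A | exists u : R, exists C : set R,
         [/\ 0 <= u <= s, measurable C & A = B u @^-1` C] ] >>.

Definition increment (s t : R) (w : Omega) : R := B t w - B s w.

Definition wiener_process : Prop :=
  [/\ {ae P, forall w, B 0 w = 0},
      (forall s t : R, 0 <= s < t ->
         forall (A : set Omega) (C : set R), past s A -> measurable C ->
         P (A `&` increment s t @^-1` C) =
         (P A * P (increment s t @^-1` C))%E),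
      (forall s t : R, 0 <= s < t ->
         has_normal_law P (increment s t) 0 (Num.sqrt (t - s))) &
      ae_continuous_paths `[0, +oo[ B].

(* The process sum_(i < n) xi_i 1_(]tau_i, tau_(i+1)]) on [0, t], with
   tau_0 <= ... <= tau_n and xi_i bounded and known at time tau_i. *)
Record elementary_process (t : R) := ElementaryProcess {
  ep_size : nat;
  ep_time : nat -> R;
  ep_coef : nat -> {RV P >-> R};
  ep_time_ge0 : 0 <= ep_time 0;
  ep_time_le : ep_time ep_size <= t;
  ep_time_homo : forall i, (i < ep_size)%N -> ep_time i <= ep_time i.+1;
  ep_coef_adapted : forall i, (i < ep_size)%N ->
    forall C : set R, measurable C -> past (ep_time i) (ep_coef i @^-1` C);
  ep_coef_bounded : forall i, (i < ep_size)%N ->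
    exists M : R, forall w, `|ep_coef i w| <= M }.

Definition ep_val (t : R) (H : elementary_process t) (s : R) (w : Omega) : R :=
  \sum_(i < ep_size H)
    ep_coef H i w * \1_(`]ep_time H i, ep_time H i.+1]) s.

Definition ep_integral (t : R) (H : elementary_process t) (w : Omega) : R :=
  \sum_(i < ep_size H)
    ep_coef H i w * increment (ep_time H i) (ep_time H i.+1) w.

Definition ep_approximates (t : R) (H : nat -> elementary_process t)
    (f : R -> R) : Prop :=
  (fun n => \int[P]_w \int[lebesgue_measure]_(s in `[0%R, t])
     ((ep_val (H n) s w - f s) ^+ 2)%R%:E)%E @ \oo --> 0%E.

(* [X] is (a version of) the Ito integral of the deterministic integrand [f]
   over [0, t]: the common L^2(P)-limit of the integrals of the sequences of
   elementary processes converging to [f] in L^2([0, t] x Omega).  By the Ito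
   isometry the limit does not depend on the sequence. *)
Definition ito_integral (t : R) (f : R -> R) (X : {RV P >-> R}) : Prop :=
  [/\ measurable_fun `[0, t] f,
      (exists H : nat -> elementary_process t, ep_approximates H f) &
      forall H : nat -> elementary_process t, ep_approximates H f ->
        (fun n => \int[P]_w ((ep_integral (H n) w - X w) ^+ 2)%R%:E)%E
          @ \oo --> 0%E].

End Wiener.

(* Main.v *)
Require Import Defs.
From HB Require Import structures.
From mathcomp Require Import all_boot all_order all_algebra.
From mathcomp Require Import all_classical all_reals all_analysis.
From mathcomp Require Import measurable_realfun ring lra.

Set Implicit Arguments.
Unset Strict Implicit.
Unset Printing Implicit Defensive.

Import Order.TTheory GRing.Theory Num.Theory.
Import numFieldNormedType.Exports.

Local Open Scope classical_set_scope.
Local Open Scope ring_scope.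

(** The process [Y] is, at every fixed time, an L2-limit of linear combinations
of values of the Wiener process: [f_t s = ((T - t) / (T - s)) `^ alpha] is
nondecreasing with values in [[0, 1]] on [[0, t]], so the step functions that
freeze it at the left ends of a regular grid are deterministic elementary
processes that converge to it ([step_approximates]).

Gaussianity. A linear combination of values of [B] is centered normal: sort
the times and peel off the increments, which are independent of the past and
normal ([has_normal_law_path_comb]); this rests on the stability of centered
normal laws under independent sums, obtained by completing the square in a
double integral ([integral_normal_convolution]). An L2-limit of centered normal
variables is centered normal ([has_normal_law_l2_limit]): the second moments
bound the standard deviations, a subsequence of which converges, and expectations
of bounded Lipschitz functions determine a law ([eq_probability_lipschitz]).
Both arguments apply to any finite linear combination of values of [Y]; the mean
vanishes because the standard normal law is symmetric.

Continuity at [T]. Instead of a maximal inequality for the martingale part,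
the proof is pathwise. Summation by parts turns the integral of the step
function into an average of the differences [B_t - B_s] against the increments
of [f_t]. The weight that [f_t] gives to the times before a fixed [r < T] is
[f_t r], which tends to 0 when [t] tends to [T], and after [r] the differences
are small since [B] is continuous at [T] ([step_bound]). The resulting bound
does not depend on the grid, so it passes to [Y] at all rational times outside
one null set, and then to all times by continuity on [[0, T[]
([bridge_path_continuous]). *)

(** * Laws on the real line *)

Section density.
Context {R : realType}.
Notation mu := (@lebesgue_measure R).

(** Any Radon-Nikodym derivative of [normal_prob] agrees almost everywhere with
[normal_pdf], so the abstract change of variables becomes an integral against
the density. *)
Lemma ge0_integral_normal_prob (m s : R) (f : R -> \bar R) :
  measurable_fun setT f -> (forall x, 0 <= f x)%E ->
  (\int[normal_prob m s]_x f x = \int[mu]_x (f x * (normal_pdf m s x)%:E))%E.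
Proof.
move=> mf f0.
have dom := normal_prob_dominates m s.
rewrite -(@Radon_Nikodym_SigmaFinite.change_of_variables _ _ _ (normal_prob m s) mu)//.
apply: ae_eq_integral => //.
- apply: emeasurable_funM => //.
  by apply: measurable_int; exact: (Radon_Nikodym_SigmaFinite.f_integrable dom).
- apply: emeasurable_funM => //; apply/measurable_EFinP.
  exact: measurable_normal_pdf.
- apply: ae_eqe_mul2l => /=; apply: integral_ae_eq => //.
  + exact: (Radon_Nikodym_SigmaFinite.f_integrable dom).
  + by apply/measurable_EFinP; exact: measurable_normal_pdf.
  + by move=> E _ mE; rewrite -Radon_Nikodym_SigmaFinite.f_integral.
Qed.

Lemma clip_lipschitz (u v : R) :
  `|Num.min 1 (Num.max 0 u) - Num.min 1 (Num.max 0 v)| <= `|u - v|.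
Proof.
wlog uv : u v / u <= v => [H|].
  by case: (leP u v) => [/H//|/ltW/H]; rewrite distrC [leRHS]distrC.
rewrite [leRHS]distrC [leRHS]ger0_norm ?subr_ge0// ler_norml.
by rewrite /Num.min /Num.max; do !case: ifPn; rewrite -?leNgt => *; lra.
Qed.

(** The Lipschitz ramps [min 1 (max 0 (n * (x - a)))] increase to the indicator
of [`]a, +oo[], and these half-lines form a pi-system that generates the
Borel sets. *)
Lemma eq_probability_lipschitz (p q : probability (measurableTypeR R) R) :
  (forall (g : R -> R) (L : R), (forall x, 0 <= g x <= 1) ->
     (forall x y, `|g x - g y| <= L * `|x - y|) ->
     (\int[p]_x (g x)%:E = \int[q]_x (g x)%:E)%E) ->
  forall C, measurable C -> p C = q C.
Proof.
move=> pq.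
have pqr (a : R) : p `]a, +oo[%classic = q `]a, +oo[%classic.
  pose g (n : nat) (x : R) : R := Num.min 1 (Num.max 0 (n%:R * (x - a))).
  have g01 n x : 0 <= g n x <= 1.
    by rewrite /g le_min ler01 le_max lexx ge_min lexx.
  have gL n x y : `|g n x - g n y| <= n%:R * `|x - y|.
    rewrite (le_trans (clip_lipschitz _ _))// -mulrBr normrM normr_nat.
    by rewrite opprB addrA subrK.
  have mg n : measurable_fun setT (g n).
    apply: measurable_minr => //; apply: measurable_maxr => //.
    by apply: measurable_funM => //; exact: measurable_funB.
  have gc x : (g n x)%:E @[n --> \oo] --> (\1_(`]a, +oo[%classic) x : R)%:E.
    apply: cvg_EFin; first exact: nearW.
    apply: cvg_near_cst; rewrite indicE.
    have [ax|xa] := ltP a x.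
      near=> n; rewrite mem_set/= ?in_itv/= ?andbT// /g min_l// le_max.
      apply/orP; right; rewrite -ler_pdivrMr ?subr_gt0//.
      near: n; exact: nbhs_infty_ger.
    apply: nearW => n; rewrite memNset/= ?in_itv/= ?andbT ?ltNge ?xa//.
    rewrite /g max_l ?min_r//.
    by rewrite mulr_ge0_le0// subr_le0.
  have H (r : probability (measurableTypeR R) R) : r `]a, +oo[%classic =
     limn (fun n => \int[r]_x (g n x)%:E)%E.
    transitivity (\int[r]_x (\1_(`]a, +oo[%classic) x)%:E)%E.
      by rewrite integral_indic// setIT.
    rewrite -monotone_convergence//.
    - by apply: eq_integral => x _; apply/esym/cvg_lim.
    - by move=> n; apply/measurable_EFinP; exact: mg.
    - by move=> n x _; rewrite lee_fin; case/andP: (g01 n x).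
    - move=> x _ n m nm; rewrite lee_fin /g.
      rewrite le_min ge_min lexx/= ge_min; apply/orP.
      have [xa|ax] := leP x a.
        by right; rewrite !max_l// mulr_ge0_le0// subr_le0.
      right; rewrite ge_max !le_max lexx/=; apply/orP; right.
      by rewrite ler_wpM2r ?ler_nat// subr_ge0 ltW.
  rewrite !H; congr (limn _); apply/funext => n.
  exact: (pq _ n%:R).
move=> C mC.
have H := @measure_unique _ R (measurableTypeR R) (@RGenOInfty.G R)
  (fun n => `]- n%:R, +oo[%classic) _ _ _ _ p q.
apply: H => //.
- exact: RGenOInfty.measurableE.
- move=> _ _ [a ->] [b ->]; exists (Num.max a b).
  by apply/seteqP; split => x /=; rewrite !in_itv/= !andbT gt_max;
    [case=> -> ->|case/andP].
- by move=> n; eexists.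
- rewrite -subTset => x _; exists (Num.trunc `|x|).+1 => //=.
  by rewrite in_itv/= andbT; case/ltr_normlP: (truncnS_gt `|x|); rewrite ltrNl.
- by move=> _ [a ->]; exact: pqr.
- by move=> n; rewrite (le_lt_trans (probability_le1 _ _)) ?ltry//;
    exact: measurable_itv.
Unshelve. all: by end_near. Qed.
End density.

(** The Borel structure on [R] exists under two displays; laws are formed in
[measurableTypeR R], where the normal and Lebesgue measures live. *)
Definition mfun_of d (T : measurableType d) (R : realType)
    (f : T -> measurableTypeR R) (mf : measurable_fun setT f) :
    {mfun T >-> measurableTypeR R} :=
  HB.pack f (isMeasurableFun.Build _ _ _ _ _ mf).

Section scaling.
Context {R : realType}.
Notation mu := (@lebesgue_measure R).

Lemma ge0_integral_affine (k c : R) (G : R -> R) : 0 < k -> continuous G ->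
  (forall x, 0 <= G x) ->
  (\int[mu]_x (G x)%:E = \int[mu]_x (G (k * x + c) * k)%:E)%E.
Proof.
move=> k0 cG G0; pose F (x : R^o) : R^o := k * x + c.
have F' (x : R^o) : is_derive x (1 : R^o) F k.
  rewrite /F; apply: is_derive_eq.
  by rewrite /GRing.scale/=; ring.
have F'E : (F^`())%classic = cst k.
  by apply/funext => x; rewrite derive1E derive_val.
rewrite (@increasing_ge0_integration_by_substitutionT R F G)//.
- by apply: eq_integral => x _; rewrite F'E.
- by move=> x y xy; rewrite /F ltrD2r ltr_pM2l.
- by rewrite F'E => x; exact: cvg_cst.
- by rewrite F'E; exact: is_cvg_cst.
- by rewrite F'E; exact: is_cvg_cst.
- apply/cvgrNyPle => A.
  apply: filterS (nbhs_ninfty_le (num_real ((A - c) / k))) => x.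
  by rewrite ler_pdivlMr// /F mulrC lerBrDr.
- apply/cvgryPge => A.
  apply: filterS (nbhs_pinfty_ge (num_real ((A - c) / k))) => x.
  by rewrite ler_pdivrMr// /F mulrC lerBlDr.
Qed.

Lemma lipschitz_continuous (g : R -> R) (L : R) :
  (forall x y, `|g x - g y| <= L * `|x - y|) -> continuous g.
Proof.
move=> gL x; apply/cvgrPdist_lt => e e0; near=> y.
rewrite (le_lt_trans (gL _ _))//.
have L1 : 0 < `|L| + 1 by rewrite ltr_wpDl.
rewrite (@le_lt_trans _ _ ((`|L| + 1) * `|x - y|))//.
  by rewrite ler_wpM2r// (le_trans (ler_norm _))// lerDl.
rewrite mulrC -ltr_pdivlMr//; near: y.
by apply: (@cvgr_dist_lt _ R^o _ _ _ id x); rewrite ?divr_gt0//; exact: cvg_id.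
Unshelve. all: by end_near. Qed.

Lemma normal_peak_inv (s : R) : 0 < s -> normal_peak s = normal_peak 1 / s.
Proof.
move=> s0; rewrite /normal_peak expr1n mul1r -mulrnAr sqrtrM ?sqr_ge0//.
by rewrite sqrtr_sqr gtr0_norm// invfM mulrC.
Qed.

(** Centered normal laws, the point mass included, are the images of the
standard one by dilations. This treats all standard deviations at once and makes
the dependence on [s] visibly continuous. *)
Lemma normal_lawE (s : R) (C : set R) : 0 <= s -> measurable C ->
  normal_law 0 s C = normal_prob 0 1 ((fun x => s * x) @^-1` C).
Proof.
rewrite le_eqVlt /normal_law => /predU1P[<-|s0] mC.
  rewrite eqxx diracE; case: (boolP (0 \in C)) => C0.
    rewrite (_ : _ @^-1` C = setT) ?probability_setT//.
    by apply/seteqP; split => // x _ /=; rewrite mul0r; apply/set_mem.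
  rewrite (_ : _ @^-1` C = set0) ?measure0//.
  by apply/seteqP; split => // x /=; rewrite mul0r => /mem_set; rewrite (negbTE C0).
rewrite (gt_eqF s0).
have mh : measurable_fun setT (fun x : measurableTypeR R => s * x).
  exact: measurable_funM.
rewrite -[RHS]/(distribution (normal_prob 0 1) (mfun_of mh) C).
apply: (@eq_probability_lipschitz R (normal_prob 0 s)
  (distribution (normal_prob 0 1) (mfun_of mh))); last exact: mC.
move=> g L g01 gL.
have cg : continuous g.
  exact: lipschitz_continuous gL.
have mg : measurable_fun setT (EFin \o g).
  by apply/measurable_EFinP; exact: continuous_measurable_fun.
have g0 x : 0 <= g x by case/andP: (g01 x).
rewrite (@ge0_integral_distribution _ _ _ _ _ (normal_prob 0 1) (mfun_of mh)
  (EFin \o g) mg); last first.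
  by move=> y; rewrite lee_fin.
rewrite ge0_integral_normal_prob; [|exact: mg|by move=> y; rewrite lee_fin].
rewrite ge0_integral_normal_prob; [|exact: measurableT_comp mg mh|by move=> y;
  rewrite lee_fin].
under eq_integral do rewrite -EFinM.
rewrite (@ge0_integral_affine s 0); [|by []| |]; last 2 first.
- by move=> x; apply: cvgM; [exact: cg|apply: continuous_normal_pdf; rewrite gt_eqF].
- by move=> x; rewrite mulr_ge0 ?normal_pdf_ge0.
apply: eq_integral => x _; rewrite addr0 -EFinM; congr EFin => /=.
rewrite -mulrA; congr (_ * _).
rewrite !normal_pdfE ?gt_eqF// normal_peak_inv// /normal_fun !subr0.
rewrite mulrAC divfK ?gt_eqF//; congr (_ * expR _).
by field; rewrite gt_eqF.
Qed.

End scaling.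

(** * Centered normal laws *)

Section convolution.
Context {R : realType}.
Notation mu := (@lebesgue_measure R).
Notation N1 := (@normal_prob R 0 1).

(** Completing the square: in the variables [x] and [z = (a x + b y) / c] the
joint density factors as the density of [z] times the conditional density
of [x] given [z], which is again normal and hence integrates to 1. *)
Lemma normal_pdf_complete_square (a b c x z : R) : 0 < a -> 0 < b -> 0 < c ->
  c ^+ 2 = a ^+ 2 + b ^+ 2 ->
  normal_pdf 0 1 x * (normal_pdf 0 1 (c / b * z - a / b * x) * (c / b)) =
  normal_pdf 0 1 z * normal_pdf (a * z / c) (b / c) x.
Proof.
move=> a0 b0 c0 cab.
have bc0 : 0 < b / c by rewrite divr_gt0.
rewrite !normal_pdfE ?gt_eqF// (normal_peak_inv bc0) invf_div.
rewrite [LHS](_ : _ = normal_peak 1 * (normal_peak 1 * (c / b)) *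
  (normal_fun 0 1 x * normal_fun 0 1 (c / b * z - a / b * x))); last by ring.
rewrite [RHS](_ : _ = normal_peak 1 * (normal_peak 1 * (c / b)) *
  (normal_fun 0 1 z * normal_fun (a * z / c) (b / c) x)); last by ring.
congr (_ * _); rewrite /normal_fun -!expRD; congr expR; apply/eqP.
rewrite -subr_eq0; apply/eqP.
rewrite [LHS](_ : _ =
  (x ^+ 2 - z ^+ 2) * (c ^+ 2 - (a ^+ 2 + b ^+ 2)) / (b ^+ 2 *+ 2)).
  by rewrite cab subrr mulr0 mul0r.
by field; rewrite !gt_eqF.
Qed.

(** For fixed [x], substitute [y = (c z - a x) / b], exchange the integrals and
integrate [x] out by [normal_pdf_complete_square]. *)
Lemma integral_normal_convolution_gt0 (a b : R) (g : R -> R) : 0 < a -> 0 < b ->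
  continuous g -> (forall x, 0 <= g x) ->
  (\int[N1]_x \int[N1]_y (g (a * x + b * y))%:E =
   \int[N1]_z (g (Num.sqrt (a ^+ 2 + b ^+ 2) * z))%:E)%E.
Proof.
move=> a0 b0 cg g0; set c := Num.sqrt _.
have mg : measurable_fun setT g by exact: continuous_measurable_fun.
have c0 : 0 < c by rewrite sqrtr_gt0 addr_gt0// exprn_gt0.
have cab : c ^+ 2 = a ^+ 2 + b ^+ 2 by rewrite sqr_sqrtr// addr_ge0// sqr_ge0.
pose h (p : measurableTypeR R * measurableTypeR R) : R :=
  normal_pdf 0 1 p.1 * (normal_pdf 0 1 (c / b * p.2 - a / b * p.1) * (c / b)) *
  g (c * p.2).
have mpdf := @measurable_normal_pdf R 0 1.
have mab x : measurable_fun setT (fun y => g (a * x + b * y)).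
  apply: measurableT_comp => //.
  by apply: measurable_funD => //; exact: measurable_funM.
have inner (x : R) :
    (\int[N1]_y (g (a * x + b * y))%:E * (normal_pdf 0 1 x)%:E =
     \int[mu]_z (h (x, z))%:E)%E.
  rewrite ge0_integral_normal_prob; last 2 first.
  - by apply/measurable_EFinP; exact: mab.
  - by move=> y; rewrite lee_fin.
  rewrite -ge0_integralZr; last 4 first.
  - exact: measurableT.
  - by apply/measurable_EFinP/measurable_funM; [exact: mab|exact: mpdf].
  - by move=> y _; rewrite mule_ge0// lee_fin ?normal_pdf_ge0.
  - by rewrite lee_fin normal_pdf_ge0.
  under eq_integral do rewrite -!EFinM.
  rewrite (@ge0_integral_affine _ (c / b) (- (a / b * x)) (fun y =>
    g (a * x + b * y) * normal_pdf 0 1 y * normal_pdf 0 1 x)); last 3 first.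
  - by rewrite divr_gt0.
  - move=> y; apply: cvgM; last exact: cvg_cst.
    apply: cvgM; last by apply: continuous_normal_pdf; rewrite oner_eq0.
    apply: continuous_comp; last exact: cg.
    apply: cvgD; first exact: cvg_cst.
    by apply: cvgM; [exact: cvg_cst|exact: cvg_id].
  - by move=> y; rewrite !mulr_ge0 ?normal_pdf_ge0.
  apply: eq_integral => z _; congr EFin; rewrite /h/=.
  rewrite (_ : a * x + _ = c * z); last by field; rewrite gt_eqF.
  by ring.
rewrite ge0_integral_normal_prob; last 2 first.
- apply: (@measurable_fun_fubini_tonelli_F _ _ _ _ _ N1
    (fun p : measurableTypeR R * measurableTypeR R => (g (a * p.1 + b * p.2))%:E)).
  + apply/measurable_EFinP/measurableT_comp => //.
    by apply: measurable_funD; apply: measurable_funM.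
  + by move=> p; rewrite lee_fin.
- by move=> x; apply: integral_ge0 => y _; rewrite lee_fin.
under eq_integral do rewrite inner.
rewrite (fubini_tonelli (fun p => (h p)%:E)); last 2 first.
- apply/measurable_EFinP; apply: measurable_funM; last first.
    by apply: measurableT_comp => //; exact: measurable_funM.
  apply: measurable_funM; first exact: measurableT_comp.
  apply: measurable_funM => //; apply: measurableT_comp => //.
  by apply: measurable_funB; apply: measurable_funM.
- by move=> p; rewrite lee_fin /h !mulr_ge0 ?normal_pdf_ge0 ?invr_ge0// ltW.
rewrite ge0_integral_normal_prob; last 2 first.
- by apply/measurable_EFinP/measurableT_comp => //; exact: measurable_funM.
- by move=> y; rewrite lee_fin.
apply: eq_integral => z _.
rewrite /h/=; under eq_integral => x _.
  rewrite (normal_pdf_complete_square x z a0 b0 c0 cab).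
  rewrite mulrAC EFinM.
  over.
rewrite ge0_integralZl; last 4 first.
- exact: measurableT.
- by apply/measurable_EFinP; exact: measurable_normal_pdf.
- by move=> x _; rewrite lee_fin normal_pdf_ge0.
- by rewrite lee_fin mulr_ge0 ?normal_pdf_ge0.
by rewrite integral_normal_pdf mule1 -EFinM mulrC.
Qed.
End convolution.

Section standard_normal.
Context {R : realType}.
Notation mu := (@lebesgue_measure R).
Notation N1 := (@normal_prob R 0 1).

Lemma integral_normal_convolution (a b : R) (g : R -> R) : 0 <= a -> 0 <= b ->
  continuous g -> (forall x, 0 <= g x) ->
  (\int[N1]_x \int[N1]_y (g (a * x + b * y))%:E =
   \int[N1]_z (g (Num.sqrt (a ^+ 2 + b ^+ 2) * z))%:E)%E.
Proof.
have N1T : N1 setT = 1%E by exact: probability_setT.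
rewrite le_eqVlt => /predU1P[<- b0 _ _|a0].
  rewrite expr0n/= add0r sqrtr_sqr ger0_norm//.
  under eq_integral do under eq_integral do rewrite mul0r add0r.
  by rewrite integral_cst//= N1T mule1.
rewrite le_eqVlt => /predU1P[<- _ _|b0]; last exact: integral_normal_convolution_gt0.
rewrite expr0n/= addr0 sqrtr_sqr gtr0_norm//.
apply: eq_integral => x _.
under eq_integral do rewrite mul0r addr0.
by rewrite integral_cst//= N1T mule1.
Qed.

(** Finiteness follows from a comparison with the density of standard deviation 2,
and positivity holds because the law has no atom at 0. *)
Lemma normal_second_moment :
  exists2 v : R, 0 < v & (\int[N1]_x (x ^+ 2)%:E = v%:E)%E.
Proof.
have msqr : measurable_fun setT (fun x : measurableTypeR R => (x ^+ 2)%:E).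
  by apply/measurable_EFinP; exact: measurable_funX.
have I0 : (0 <= \int[N1]_x (x ^+ 2)%:E)%E.
  by apply: integral_ge0 => x _; rewrite lee_fin sqr_ge0.
have Ifin : (\int[N1]_x (x ^+ 2)%:E < +oo)%E.
  rewrite ge0_integral_normal_prob; [|exact: msqr|by move=> x; rewrite lee_fin sqr_ge0].
  apply: (@le_lt_trans _ _ (\int[mu]_x ((16 / 3)%:E * (normal_pdf 0 2 x)%:E))%E).
    apply: ge0_le_integral.
    - exact: measurableT.
    - by move=> x _; rewrite -EFinM lee_fin mulr_ge0 ?normal_pdf_ge0 ?sqr_ge0.
    - by apply: emeasurable_funM; [exact: msqr|apply/measurable_EFinP;
        exact: measurable_normal_pdf].
    - by apply: emeasurable_funM => //; apply/measurable_EFinP;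
        exact: measurable_normal_pdf.
    - move=> x _; rewrite -!EFinM lee_fin !normal_pdfE ?oner_eq0 ?pnatr_eq0//.
      rewrite (@normal_peak_inv _ 2)// /normal_fun !subr0.
      rewrite [leRHS](_ :
        _ = normal_peak 1 * (8 / 3 * expR (- x ^+ 2 / (2 ^+ 2 *+ 2)))); last by field.
      rewrite mulrCA ler_wpM2l ?normal_peak_ge0//.
      rewrite (_ : - x ^+ 2 / (1 ^+ 2 *+ 2) =
        - (3 / 8 * x ^+ 2) + - x ^+ 2 / (2 ^+ 2 *+ 2)); last by field.
      rewrite expRD mulrA ler_wpM2r ?expR_ge0//.
      rewrite expRN ler_pdivrMr ?expR_gt0//.
      (* [u <= expR u] for [u = 3 x^2 / 8], the gap between the exponents *)
      rewrite mulrC -ler_pdivrMr// invf_div mulrC.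
      by rewrite (le_trans _ (expR_ge1Dx _))// lerDr.
  rewrite ge0_integralZl; last 4 first.
  - exact: measurableT.
  - by apply/measurable_EFinP; exact: measurable_normal_pdf.
  - by move=> x _; rewrite lee_fin normal_pdf_ge0.
  - by rewrite lee_fin.
  by rewrite integral_normal_pdf mule1 ltry.
exists (fine (\int[N1]_x (x ^+ 2)%:E)%E); last by rewrite fineK// ge0_fin_numE.
rewrite fine_gt0// Ifin andbT lt_neqAle I0 andbT; apply/eqP => /esym I00.
have N10 : N1 [set 0] = 0%E.
  have := normal_prob_dominates (0 : R) 1; move/null_content_dominatesP; apply => //.
  exact: lebesgue_measure_set1.
have /ae_eq_integral_abs : (\int[N1]_x `|(x ^+ 2)%:E| = 0)%E.
  by rewrite -[RHS]I00; apply: eq_integral => x _; rewrite gee0_abs// lee_fin sqr_ge0.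
move=> /(_ measurableT msqr) ae0.
have NC0 : N1 (~` [set 0]) = 0%E.
  apply/negligibleP; first by apply: measurableC; exact: measurable_set1.
  apply: negligibleS ae0 => x /= x0 /(_ I) [] /eqP.
  by rewrite sqrf_eq0 => /eqP.
have : N1 setT = 0%E.
  have m0 : measurable ([set 0] : set (measurableTypeR R)) by exact: measurable_set1.
  rewrite -(setUv [set 0]) measureU; [|exact: m0|exact: measurableC|exact: setICr].
  by rewrite [X in (X + _)%E]N10 [X in (_ + X)%E]NC0 adde0.
by rewrite probability_setT => /eqP; rewrite eqe oner_eq0.
Qed.

End standard_normal.

Section laws.
Context {d : measure_display} {T : measurableType d} {R : realType}.
Variable P : probability T R.
Notation N1 := (@normal_prob R 0 1).

Lemma integral_normal_law (X : T -> R) (s : R) (f : R -> \bar R) :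
  measurable_fun setT X -> 0 <= s -> has_normal_law P X 0 s ->
  measurable_fun setT f -> (forall x, (0 <= f x)%E) ->
  (\int[P]_w f (X w) = \int[N1]_x f (s * x)%R)%E.
Proof.
move=> mX s0 hX mf f0.
have mh : measurable_fun setT (fun x : measurableTypeR R => s * x).
  exact: measurable_funM.
rewrite -[LHS](@ge0_integral_distribution _ _ _ _ _ P (mfun_of mX) f mf f0).
rewrite -[RHS](@ge0_integral_distribution _ _ _ _ _ N1 (mfun_of mh) f mf f0).
apply: eq_measure_integral => A mA _.
transitivity (normal_law 0 s A); first exact: hX.
exact: normal_lawE.
Qed.

Lemma has_normal_law_lipschitz (X : T -> R) (s : R) :
  measurable_fun setT X -> 0 <= s ->
  (forall (g : R -> R) (L : R), (forall x, 0 <= g x <= 1) ->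
     (forall x y, `|g x - g y| <= L * `|x - y|) ->
     (\int[P]_w (g (X w))%:E = \int[N1]_x (g (s * x))%:E)%E) ->
  has_normal_law P X 0 s.
Proof.
move=> mX s0 hg C mC.
have mh : measurable_fun setT (fun x : measurableTypeR R => s * x).
  exact: measurable_funM.
rewrite normal_lawE; [|exact: s0|exact: mC].
apply: (@eq_probability_lipschitz R (distribution P (mfun_of mX))
  (distribution N1 (mfun_of mh))); last exact: mC.
move=> g L g01 gL.
have mg : measurable_fun setT (EFin \o g).
  apply/measurable_EFinP; apply: continuous_measurable_fun.
  exact: lipschitz_continuous gL.
have g0 x : (0 <= (EFin \o g) x)%E by rewrite lee_fin; case/andP: (g01 x).
rewrite [LHS](@ge0_integral_distribution _ _ _ _ _ P (mfun_of mX) _ mg g0).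
rewrite [RHS](@ge0_integral_distribution _ _ _ _ _ N1 (mfun_of mh) _ mg g0).
exact: hg g01 gL.
Qed.

(** The product rule identifies the joint law of [X] and [Y] with the product of
their laws; Tonelli and [integral_normal_convolution] then give the expectation of
every test function of the sum. *)
Lemma has_normal_law_add (X Y : T -> R) (a b : R) :
  measurable_fun setT X -> measurable_fun setT Y -> 0 <= a -> 0 <= b ->
  has_normal_law P X 0 a -> has_normal_law P Y 0 b ->
  (forall A C : set R, measurable A -> measurable C ->
     P (X @^-1` A `&` Y @^-1` C) = (P (X @^-1` A) * P (Y @^-1` C))%E) ->
  has_normal_law P (fun w => X w + Y w) 0 (Num.sqrt (a ^+ 2 + b ^+ 2)).
Proof.
move=> mX mY a0 b0 hX hY XY.
apply: has_normal_law_lipschitz; [exact: measurable_funD|exact: sqrtr_ge0|].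
move=> g L g01 gL.
have cg := lipschitz_continuous gL.
have mg : measurable_fun setT (EFin \o g).
  by apply/measurable_EFinP; exact: continuous_measurable_fun.
have g0 x : (0 <= (EFin \o g) x)%E by rewrite lee_fin; case/andP: (g01 x).
have gge0 x : 0 <= g x by case/andP: (g01 x).
rewrite -integral_normal_convolution; [|exact: a0|exact: b0|exact: cg|exact: gge0].
pose XYw (w : T) : measurableTypeR R * measurableTypeR R := (X w, Y w).
have mXY : measurable_fun setT XYw by exact: measurable_fun_pair.
pose f (p : measurableTypeR R * measurableTypeR R) := (g (p.1 + p.2))%:E.
have mf : measurable_fun setT f.
  by apply: (measurableT_comp mg); exact: measurable_funD.
have f0 p : (0 <= f p)%E by rewrite lee_fin.
transitivity (\int[pushforward P XYw]_p f p)%E.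
  by rewrite ge0_integral_pushforward.
transitivity (\int[distribution P (mfun_of mX) \x distribution P (mfun_of mY)]_p f p)%E.
  apply: eq_measure_integral => A mA _; apply/esym.
  apply: product_measure_unique => //.
rewrite fubini_tonelli1; [|exact: mf|exact: f0].
have F (x : R) : (\int[distribution P (mfun_of mY)]_y (g (x + y))%:E =
  \int[N1]_y (g (x + b * y))%:E)%E.
  have mgx : measurable_fun setT (fun y => (g (x + y))%:E).
    by apply: (measurableT_comp mg); exact: measurable_funD.
  have gx0 y : (0 <= (g (x + y))%:E)%E by rewrite lee_fin.
  rewrite (@ge0_integral_distribution _ _ _ _ _ P (mfun_of mY) _ mgx gx0).
  exact: (integral_normal_law mY b0 hY mgx gx0).
rewrite /fubini_F/=; under eq_integral do rewrite F.
have mF : measurable_fun setT (fun x : R => \int[N1]_y (g (x + b * y))%:E)%E.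
  apply: (@measurable_fun_fubini_tonelli_F _ _ _ _ _ N1
    (fun p : measurableTypeR R * measurableTypeR R => (g (p.1 + b * p.2))%:E)).
  - apply: (measurableT_comp mg).
    by apply: measurable_funD => //; apply: measurable_funM.
  - by move=> p; rewrite lee_fin.
have F0 (x : R) : (0 <= \int[N1]_y (g (x + b * y))%:E)%E.
  by apply: integral_ge0 => y _; rewrite lee_fin.
rewrite (@ge0_integral_distribution _ _ _ _ _ P (mfun_of mX) _ mF F0).
exact: (integral_normal_law mX a0 hX mF F0).
Qed.

End laws.

(** * Limits in the mean square *)

Definition l2_cvg d (T : measurableType d) (R : realType) (P : probability T R)
    (Z : nat -> T -> R) (X : T -> R) : Prop :=
  (fun n => \int[P]_w ((Z n w - X w) ^+ 2)%:E)%E @ \oo --> 0%E.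

Lemma ge0_cvge0P (R : realType) (u : nat -> \bar R) : (forall n, (0 <= u n)%E) ->
  (u @ \oo --> 0%E) <-> (forall e : R, 0 < e -> \forall n \near \oo, (u n <= e%:E)%E).
Proof.
move=> u0; split=> [/fine_cvgP[ufin u_0] e e0|H].
  move/cvgrPdist_le : u_0 => /(_ _ e0); near_simpl => u_e.
  near=> n; rewrite -[u n]fineK; last by near: n.
  rewrite lee_fin (le_trans (ler_norm _))// -normrN -[X in `|X|]add0r.
  by near: n.
apply/fine_cvgP; split.
  near=> n; rewrite ge0_fin_numE//; apply: (@le_lt_trans _ _ 1%:E); last exact: ltry.
  by near: n; apply: H.
apply/cvgrPdist_le => e e0; near=> n.
rewrite sub0r normrN ger0_norm ?fine_ge0//=.
rewrite -lee_fin fineK.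
  by near: n; exact: H.
rewrite ge0_fin_numE//; apply: (@le_lt_trans _ _ 1%:E); last exact: ltry.
by near: n; apply: H.
Unshelve. all: by end_near. Qed.

Section l2.
Context {d : measure_display} {T : measurableType d} {R : realType}.
Variable P : probability T R.
Notation N1 := (@normal_prob R 0 1).

Lemma measurable_sqrB (X Y : T -> R) : measurable_fun setT X ->
  measurable_fun setT Y -> measurable_fun setT (fun w => ((X w - Y w) ^+ 2)%:E).
Proof.
by move=> mX mY; apply/measurable_EFinP/measurable_funX; exact: measurable_funB.
Qed.

(** Quantitative continuity of expectations of a Lipschitz function in the mean
square: [L r <= e + L^2 r^2 / e] for all [r >= 0], by the inequality between the
arithmetic and geometric means. *)
Lemma integral_lipschitz_le (X Y : T -> R) (g : R -> R) (L e : R) :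
  measurable_fun setT X -> measurable_fun setT Y -> 0 < e ->
  (forall x, 0 <= g x) -> (forall x y, `|g x - g y| <= L * `|x - y|) ->
  (\int[P]_w (g (X w))%:E <= \int[P]_w (g (Y w))%:E + (e%:E +
     (L ^+ 2 / e)%:E * \int[P]_w ((X w - Y w) ^+ 2)%:E))%E.
Proof.
move=> mX mY e0 g0 gL.
have mg : measurable_fun setT g.
  by apply: continuous_measurable_fun; exact: lipschitz_continuous gL.
have mgX : measurable_fun setT (fun w => (g (X w))%:E).
  by apply/measurable_EFinP; exact: measurableT_comp.
have mgY : measurable_fun setT (fun w => (g (Y w))%:E).
  by apply/measurable_EFinP; exact: measurableT_comp.
have mXY := measurable_sqrB mX mY.
have c0 : 0 <= L ^+ 2 / e by rewrite divr_ge0 ?sqr_ge0 ?ltW.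
have XY0 w : (0 <= ((X w - Y w) ^+ 2)%:E)%E by rewrite lee_fin sqr_ge0.
have -> : (e%:E = \int[P]_w (cst e%:E w))%E.
  by rewrite integral_cst// [X in (_ * X)%E]probability_setT mule1.
rewrite -ge0_integralZl//.
rewrite -ge0_integralD//; last 3 first.
- by move=> w _; rewrite lee_fin ltW.
- by move=> w _; rewrite mule_ge0.
- by apply: emeasurable_funM.
rewrite -ge0_integralD//; last 3 first.
- by move=> w _; rewrite lee_fin.
- by move=> w _; rewrite adde_ge0// ?mule_ge0// lee_fin ltW.
- by apply: emeasurable_funD => //; exact: emeasurable_funM.
apply: ge0_le_integral => //.
- by move=> w _; rewrite lee_fin.
- by apply: emeasurable_funD => //; apply: emeasurable_funD => //;
    exact: emeasurable_funM.
move=> w _; rewrite -EFinM -!EFinD lee_fin -lerBlDl.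
apply: (le_trans (ler_norm _)); apply: (le_trans (gL _ _)).
rewrite -[(X w - Y w) ^+ 2]real_normK ?num_real//.
set r : R := `|_|; rewrite -subr_ge0.
rewrite (_ : _ - _ = ((e - L * r / 2) ^+ 2 + 3 / 4 * (L * r) ^+ 2) / e); last first.
  by field; rewrite gt_eqF.
by apply: divr_ge0; [rewrite addr_ge0 ?sqr_ge0// mulr_ge0 ?sqr_ge0|exact: ltW].
Qed.

Lemma integral_sqr_normal_law (X : T -> R) (s v : R) :
  measurable_fun setT X -> 0 <= s -> has_normal_law P X 0 s ->
  (\int[N1]_x (x ^+ 2)%:E = v%:E)%E ->
  (\int[P]_w (X w ^+ 2)%:E = (s ^+ 2 * v)%:E)%E.
Proof.
move=> mX s0 hX hv.
have msqr : measurable_fun setT (fun x : R => (x ^+ 2)%:E).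
  by apply/measurable_EFinP; exact: measurable_funX.
rewrite (@integral_normal_law _ _ _ P X s (fun x => (x ^+ 2)%:E)) => //; last first.
  by move=> x; rewrite lee_fin sqr_ge0.
under eq_integral do rewrite exprMn EFinM.
rewrite ge0_integralZl; last 4 first.
- exact: measurableT.
- exact: msqr.
- by move=> x _; rewrite lee_fin sqr_ge0.
- by rewrite lee_fin sqr_ge0.
by rewrite hv.
Qed.

Lemma integral_sqrBC (X Y : T -> R) :
  (\int[P]_w ((X w - Y w) ^+ 2)%:E = \int[P]_w ((Y w - X w) ^+ 2)%:E)%E.
Proof. by apply: eq_integral => w _; rewrite -sqrrN opprB. Qed.

Lemma integral_sqr_triangle (X Y Z : T -> R) :
  measurable_fun setT X -> measurable_fun setT Y -> measurable_fun setT Z ->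
  (\int[P]_w ((X w - Z w) ^+ 2)%:E <= 2%:E * \int[P]_w ((X w - Y w) ^+ 2)%:E +
     2%:E * \int[P]_w ((Y w - Z w) ^+ 2)%:E)%E.
Proof.
move=> mX mY mZ.
have mXY := measurable_sqrB mX mY.
have mYZ := measurable_sqrB mY mZ.
have mXZ := measurable_sqrB mX mZ.
have p0 (U V : T -> R) w : (0 <= ((U w - V w) ^+ 2)%:E)%E by rewrite lee_fin sqr_ge0.
rewrite -!ge0_integralZl//.
rewrite -ge0_integralD//; last 4 first.
- by move=> w _; rewrite mule_ge0.
- by apply: emeasurable_funM.
- by move=> w _; rewrite mule_ge0.
- by apply: emeasurable_funM.
apply: ge0_le_integral => //.
- by apply: emeasurable_funD => //; exact: emeasurable_funM.
move=> w _; rewrite -!EFinM -!EFinD lee_fin.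
rewrite -subr_ge0 (_ : _ - _ = (X w - Y w - (Y w - Z w)) ^+ 2) ?sqr_ge0//.
by ring.
Qed.

End l2.

Section l2_limit.
Context {d : measure_display} {T : measurableType d} {R : realType}.
Variable P : probability T R.
Notation N1 := (@normal_prob R 0 1).

(** The second moments bound the standard deviations, so some subsequence of them
converges, to [r] say; by [integral_lipschitz_le] both [Z n] under [P] and
[s n * x] under the standard normal law pass to the limit in expectations of
Lipschitz functions. *)
Lemma has_normal_law_l2_limit (Z : nat -> T -> R) (s : nat -> R) (X : T -> R) :
  (forall n, measurable_fun setT (Z n)) -> measurable_fun setT X ->
  (forall n, 0 <= s n) -> (forall n, has_normal_law P (Z n) 0 (s n)) ->
  l2_cvg P Z X -> exists2 r : R, 0 <= r & has_normal_law P X 0 r.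
Proof.
move=> mZ mX s0 hZ ZX.
have [v v0 hv] := @normal_second_moment R.
pose D n := (\int[P]_w ((Z n w - X w) ^+ 2)%:E)%E.
have D0 n : (0 <= D n)%E by apply: integral_ge0 => w _; rewrite lee_fin sqr_ge0.
have /ge0_cvge0P Dsmall := ZX; move/(_ D0) in Dsmall.
have [N _ HN] := Dsmall _ ltr01.
have m0 : measurable_fun setT (fun _ : T => 0 : R) by exact: measurable_cst.
have E0 (U : T -> R) : (\int[P]_w ((U w - 0) ^+ 2)%:E = \int[P]_w (U w ^+ 2)%:E)%E.
  by apply: eq_integral => w _; rewrite subr0.
have s_bnd n : (N <= n)%N -> s n ^+ 2 * v <= 6 + 4 * (s N ^+ 2 * v).
  move=> Nn; rewrite -lee_fin.
  have <- := integral_sqr_normal_law (mZ n) (s0 n) (hZ n) hv.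
  apply: (@le_trans _ _ (6%:E + 4%:E * \int[P]_w (Z N w ^+ 2)%:E)%E); last first.
    by rewrite (integral_sqr_normal_law (mZ N) (s0 N) (hZ N) hv) -EFinM -EFinD.
  rewrite -(E0 (Z n)) -(E0 (Z N)).
  have H0 := integral_sqr_triangle P (mZ n) mX m0.
  apply: (le_trans H0).
  have H1 : (2%:E * D n <= 2%:E :> \bar R)%E.
    by rewrite -[leRHS]mule1; apply: lee_wpmul2l => //; exact: HN.
  have H2 := integral_sqr_triangle P mX (mZ N) m0.
  have H3 : (\int[P]_w ((X w - Z N w) ^+ 2)%:E <= 1)%E.
    by rewrite integral_sqrBC; exact: (HN N (leqnn N)).
  rewrite (_ : (6%:E + _)%E = (2%:E + 2%:E * (2%:E +
      2%:E * \int[P]_w ((Z N w - 0) ^+ 2)%:E))%E); last first.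
    rewrite E0 (integral_sqr_normal_law (mZ N) (s0 N) (hZ N) hv).
    by rewrite -!EFinM -!EFinD; congr EFin; ring.
  apply: leeD => //; apply: lee_wpmul2l => //.
  apply: (le_trans H2); apply: leeD => //.
  by rewrite -[leRHS]mule1; apply: lee_wpmul2l.
have bnd : bounded_fun (fun n => s (n + N)%N).
  exists (Num.sqrt ((6 + 4 * (s N ^+ 2 * v)) / v)); split; first exact: num_real.
  move=> M HM n _ /=; rewrite ger0_norm// (le_trans _ (ltW HM))//.
  rewrite -[leLHS]ger0_norm// -sqrtr_sqr ler_wsqrtr// ler_pdivlMr//.
  by apply: s_bnd; exact: leq_addl.
have [f incf] := bolzano_weierstrass bnd.
move=> /cvg_ex[r /= sr].
have r0 : 0 <= r.
  rewrite -(cvg_lim _ sr)//; apply: limr_ge; first by apply/cvg_ex; exists r.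
  by apply: nearW => n; exact: s0.
exists r => //.
apply: has_normal_law_lipschitz => // g L g01 gL.
have g0 x : 0 <= g x by case/andP: (g01 x).
have f_ge k : (k <= f k)%N.
  elim: k => // k IH; apply: (leq_ltn_trans IH).
  by rewrite ltnNge -leEnat incf -ltnNge.
have ms (t : R) : measurable_fun setT (fun x : measurableTypeR R => t * x).
  exact: measurable_funM.
have msr n : (\int[N1]_x ((s n * x - r * x) ^+ 2)%:E = ((s n - r) ^+ 2 * v)%:E)%E.
  under eq_integral do rewrite -mulrBl exprMn EFinM.
  rewrite ge0_integralZl; last 4 first.
  - exact: measurableT.
  - by apply/measurable_EFinP; exact: measurable_funX.
  - by move=> x _; rewrite lee_fin sqr_ge0.
  - by rewrite lee_fin sqr_ge0.
  by rewrite hv.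
have key (e : R) : 0 < e -> exists n, ((L ^+ 2 / e)%:E * D n <= e%:E)%E /\
    ((L ^+ 2 / e)%:E * \int[N1]_x ((s n * x - r * x) ^+ 2)%:E <= e%:E)%E.
  move=> e0; set c := L ^+ 2 / e.
  have c0 : 0 <= c by rewrite divr_ge0 ?sqr_ge0 ?ltW.
  pose del := e / (c + 1).
  have del0 : 0 < del by rewrite divr_gt0 ?ltr_wpDl.
  have cdel : c * del <= e.
    by rewrite mulrCA ler_piMr ?ltW// ltr_pdivrMr ?ltr_wpDl// mul1r ltrDl.
  have [N' _ HN'] := Dsmall _ del0.
  have q0 : 0 < Num.sqrt (del / v) by rewrite sqrtr_gt0 divr_gt0.
  have /cvgrPdist_le/(_ _ q0)[K _ HK] := sr.
  pose k := maxn K N'; exists (f k + N)%N; split.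
    apply: (@le_trans _ _ (c%:E * del%:E)%E); last by rewrite -EFinM lee_fin.
    apply: lee_wpmul2l; rewrite ?lee_fin//; apply: HN' => /=.
    by rewrite (leq_trans (leq_maxr K N'))// (leq_trans (f_ge k))// leq_addr.
  rewrite msr -EFinM lee_fin (le_trans _ cdel)// ler_wpM2l//.
  rewrite -ler_pdivlMr// -[leRHS]sqr_sqrtr; last by rewrite divr_ge0 ?ltW.
  rewrite -[leLHS]real_normK ?num_real// lerXn2r ?nnegrE// ?sqrtr_ge0//.
  by rewrite distrC; apply: (HK k); rewrite /= leq_maxl.
have gZ n : (\int[P]_w (g (Z n w))%:E = \int[N1]_x (g (s n * x))%:E)%E.
  apply: (@integral_normal_law _ _ _ P (Z n) (s n) (EFin \o g)) => //.
  apply/measurable_EFinP; apply: continuous_measurable_fun.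
  exact: lipschitz_continuous gL.
have half (e : R) : e = e / 4 + e / 4 + (e / 4 + e / 4) by field.
apply/eqP; rewrite eq_le; apply/andP; split; apply/lee_addgt0Pr => e e0.
- have e40 : 0 < e / 4 by rewrite divr_gt0.
  have [n [n1 n2]] := key _ e40.
  have H1 := integral_lipschitz_le P mX (mZ n) e40 g0 gL.
  have H2 := integral_lipschitz_le N1 (ms (s n)) (ms r) e40 g0 gL.
  rewrite integral_sqrBC in H1.
  apply: (le_trans H1); rewrite gZ [in leRHS](half e) [in leRHS]EFinD [leRHS]addeA.
  apply: leeD; last by rewrite EFinD; apply: leeD.
  by apply: (le_trans H2); apply: leeD => //; rewrite EFinD; apply: leeD.
- have e40 : 0 < e / 4 by rewrite divr_gt0.
  have [n [n1 n2]] := key _ e40.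
  have H1 := integral_lipschitz_le P (mZ n) mX e40 g0 gL.
  have H2 := integral_lipschitz_le N1 (ms r) (ms (s n)) e40 g0 gL.
  rewrite integral_sqrBC in H2.
  apply: (le_trans H2); rewrite -gZ [in leRHS](half e) [in leRHS]EFinD [leRHS]addeA.
  apply: leeD; last by rewrite EFinD; apply: leeD.
  by apply: (le_trans H1); apply: leeD => //; rewrite EFinD; apply: leeD.
Qed.

Lemma integral_normalN (f : R -> \bar R) :
  measurable_fun setT f -> (forall x, (0 <= f x)%E) ->
  (\int[N1]_x f (- x)%R = \int[N1]_x f x)%E.
Proof.
move=> mf f0.
have mN : measurable_fun setT (-%R : measurableTypeR R -> measurableTypeR R).
  exact: measurable_funN.
have mfN : measurable_fun setT (fun x : R => f (- x)).
  exact: (measurableT_comp mf mN).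
rewrite ge0_integral_normal_prob; [|exact: mfN|by move=> x; exact: f0].
rewrite ge0_integral_normal_prob; [|exact: mf|by move=> x; exact: f0].
pose h (x : R) : \bar R := (f x * (normal_pdf 0 1 x)%:E)%E.
have mh : measurable_fun setT h.
  by apply: emeasurable_funM => //; apply/measurable_EFinP;
    exact: measurable_normal_pdf.
have h0 x : (0 <= h x)%E by rewrite mule_ge0// lee_fin normal_pdf_ge0.
transitivity (\int[pushforward lebesgue_measure (-%R :
  measurableTypeR R -> measurableTypeR R)]_x h x)%E; last first.
  by apply: eq_measure_integral => A mA _; exact: lebesgue_measureN.
rewrite ge0_integral_pushforward;
  [|exact: mN|exact: measurableT|exact: mh|by move=> x _; exact: h0].
apply: eq_integral => x _; rewrite /h/=.
by rewrite !normal_pdfE ?oner_eq0// /normal_fun !subr0 sqrrN.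
Qed.

(** The positive and negative parts have the same integral by the symmetry of the
standard normal law, and this integral is finite because of the second
moment. *)
Lemma integral_normal_law_eq0 (X : T -> R) (s : R) :
  measurable_fun setT X -> 0 <= s -> has_normal_law P X 0 s ->
  (\int[P]_w (X w)%:E = 0)%E.
Proof.
move=> mX s0 hX.
have [v v0 hv] := @normal_second_moment R.
have mpos : measurable_fun setT (fun x : R => (Num.max x 0)%:E).
  by apply/measurable_EFinP; exact: measurable_maxr.
have pos0 (x : R) : (0 <= (Num.max x 0)%:E)%E by rewrite lee_fin le_max lexx orbT.
pose I := (\int[N1]_x (Num.max (s * x) 0)%:E)%E.
have mneg : measurable_fun setT (fun x : R => (Num.max (- x) 0)%:E).
  by apply/measurable_EFinP; apply: measurable_maxr => //; exact: measurable_funN.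
have neg0 (x : R) : (0 <= (Num.max (- x) 0)%:E)%E by rewrite lee_fin le_max lexx orbT.
rewrite integralE.
have -> : (\int[P]_w (EFin \o X)^\+ w = I)%E.
  rewrite /I -(integral_normal_law mX s0 hX mpos pos0).
  by apply: eq_integral => w _; rewrite funeposE /= EFin_max.
have -> : (\int[P]_w (EFin \o X)^\- w = I)%E.
  have mmax : measurable_fun setT (fun x : R => (Num.max (s * x) 0)%:E).
    by apply: (measurableT_comp mpos); exact: measurable_funM.
  rewrite -[RHS](integral_normalN mmax); last by move=> x; exact: pos0.
  under [RHS]eq_integral do rewrite mulrN.
  rewrite -(integral_normal_law mX s0 hX mneg neg0).
  by apply: eq_integral => w _; rewrite funenegE /= EFin_max.
rewrite subee// ge0_fin_numE; last by apply: integral_ge0.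
apply: (@le_lt_trans _ _ (\int[N1]_x (1 + (s * x) ^+ 2)%:E)%E).
  apply: ge0_le_integral.
  - exact: measurableT.
  - by move=> x _; exact: pos0.
  - by apply: (measurableT_comp mpos); exact: measurable_funM.
  - apply/measurable_EFinP; apply: measurable_funD => //.
    by apply: measurable_funX; exact: measurable_funM.
  - move=> x _; rewrite lee_fin ge_max addr_ge0 ?sqr_ge0 ?andbT//.
    by have := sqr_ge0 (s * x - 1); nra.
under eq_integral do rewrite EFinD.
rewrite ge0_integralD; last 5 first.
- exact: measurableT.
- by move=> x _.
- exact: measurable_cst.
- by move=> x _; rewrite lee_fin sqr_ge0.
- by apply/measurable_EFinP; apply: measurable_funX; exact: measurable_funM.
rewrite integral_cst; last exact: measurableT.
rewrite [X in (_ * X + _)%E]probability_setT mule1.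
have := @integral_normal_law _ _ _ P X s (fun x => (x ^+ 2)%:E) mX s0 hX.
rewrite (integral_sqr_normal_law mX s0 hX hv) => <-.
- by rewrite -EFinD ltry.
- by apply/measurable_EFinP; exact: measurable_funX.
- by move=> x; rewrite lee_fin sqr_ge0.
Qed.

End l2_limit.

(** * Linear combinations of values of a Wiener process *)

Section law_operations.
Context {d : measure_display} {T : measurableType d} {R : realType}.
Variable P : probability T R.
Notation N1 := (@normal_prob R 0 1).

Lemma has_normal_law_ae (X Y : T -> R) (s : R) : measurable_fun setT X ->
  measurable_fun setT Y -> 0 <= s -> {ae P, forall w, X w = Y w} ->
  has_normal_law P Y 0 s -> has_normal_law P X 0 s.
Proof.
move=> mX mY s0 XY hY; apply: has_normal_law_lipschitz => // g L g01 gL.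
have g0 x : 0 <= g x by case/andP: (g01 x).
have mg : measurable_fun setT (EFin \o g).
  apply/measurable_EFinP; apply: continuous_measurable_fun.
  exact: lipschitz_continuous gL.
have eg0 x : (0 <= (EFin \o g) x)%E by rewrite lee_fin.
rewrite -[RHS](integral_normal_law mY s0 hY mg eg0).
apply: ge0_ae_eq_integral.
- exact: measurableT.
- exact: (measurableT_comp mg mX).
- exact: (measurableT_comp mg mY).
- by move=> w _; rewrite lee_fin.
- by move=> w _; rewrite lee_fin.
- by apply: filterS XY => w /= -> _.
Qed.

Lemma has_normal_law_cst0 : has_normal_law P (fun=> 0) 0 0.
Proof.
move=> C mC; rewrite /normal_law eqxx preimage_cst diracE.
by case: ifPn => _; rewrite ?probability_setT ?measure0.
Qed.

Lemma has_normal_lawZ (X : T -> R) (a s : R) : measurable_fun setT X -> 0 <= s ->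
  has_normal_law P X 0 s -> has_normal_law P (fun w => a * X w) 0 (`|a| * s).
Proof.
move=> mX s0 hX.
apply: has_normal_law_lipschitz; [exact: measurable_funM|by rewrite mulr_ge0|].
move=> g L g01 gL.
have mg : measurable_fun setT (EFin \o g).
  apply/measurable_EFinP; apply: continuous_measurable_fun.
  exact: lipschitz_continuous gL.
have mga (t : R) : measurable_fun setT (fun x : R => (g (t * x))%:E).
  by apply: (measurableT_comp mg); exact: measurable_funM.
have ga0 (t x : R) : (0 <= (g (t * x))%:E)%E.
  by rewrite lee_fin; case/andP: (g01 (t * x)).
rewrite (integral_normal_law mX s0 hX (mga a) (ga0 a)).
under eq_integral do rewrite mulrA.
have [a0|a0] := leP 0 a; first by rewrite ger0_norm.
rewrite -(integral_normalN (mga (a * s)) (ga0 _)) ltr0_norm//.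
by apply: eq_integral => x _; rewrite !mulNr mulrN.
Qed.

End law_operations.

Section wiener.
Context {d : measure_display} {T : measurableType d} {R : realType}.
Context {P : probability T R}.
Variable B : R -> {RV P >-> R}.

Definition past_measurable (s : R) (X : T -> R) : Prop :=
  forall C : set R, measurable C -> past B s (X @^-1` C).

(** The weighted times form a list, so that concatenation adds two combinations
and sorting by time does not change the value. *)
Definition path_comb (ps : seq (R * R)) (w : T) : R :=
  \sum_(p <- ps) p.1 * B p.2 w.

Lemma past_measurableP (s : R) (X : T -> R) :
  past_measurable s X <->
  @measurable_fun _ _ (g_sigma_algebraType [set A | exists u : R, exists C : set R,
         [/\ 0 <= u <= s, measurable C & A = B u @^-1` C] ]) R setT X.
Proof.
split=> [H _ C mC|H C mC]; first by rewrite setTI; exact: H.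
by have := H measurableT C mC; rewrite setTI.
Qed.

Lemma past_measurable_path_comb (ps : seq (R * R)) (s : R) :
  {in ps, forall p, 0 <= p.2 <= s} -> past_measurable s (path_comb ps).
Proof.
elim: ps => [|p ps IH] Hps; apply/past_measurableP.
  rewrite (_ : path_comb [::] = fun=> 0); last first.
    by apply/funext => w; rewrite /path_comb big_nil.
  exact: measurable_cst.
rewrite (_ : path_comb _ = fun w => p.1 * B p.2 w + path_comb ps w); last first.
  by apply/funext => w; rewrite /path_comb big_cons.
apply: measurable_funD.
  apply: measurable_funM => //.
  apply: (iffLR (past_measurableP s _)) => C mC; apply: sub_sigma_algebra.
  by exists p.2, C; split => //; apply: Hps; rewrite mem_head.
apply: (iffLR (past_measurableP s _)).
by apply: IH => q qps; apply: Hps; rewrite inE qps orbT.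
Qed.

Lemma measurable_path_comb (ps : seq (R * R)) : measurable_fun setT (path_comb ps).
Proof.
rewrite /path_comb; apply: measurable_sum => p.
exact: measurable_funM.
Qed.

Hypothesis wB : wiener_process B.

Lemma has_normal_law_add_increment (X : T -> R) (a s u v : R) :
  measurable_fun setT X -> past_measurable u X -> 0 <= s -> has_normal_law P X 0 s ->
  0 <= u <= v ->
  exists2 r, 0 <= r & has_normal_law P (fun w => X w + a * increment B u v w) 0 r.
Proof.
move=> mX pX s0 hX /andP[u0]; rewrite le_eqVlt => /predU1P[<-|uv].
  exists s => //; rewrite (_ : (fun w => _) = X)//.
  by apply/funext => w; rewrite /increment subrr mulr0 addr0.
have [_ indep law _] := wB.
have mI : measurable_fun setT (increment B u v) by exact: measurable_funB.
have q0 : 0 <= Num.sqrt (v - u) by exact: sqrtr_ge0.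
have huv : 0 <= u < v by rewrite u0.
have hI := has_normal_lawZ a mI q0 (law u v huv).
exists (Num.sqrt (s ^+ 2 + (`|a| * Num.sqrt (v - u)) ^+ 2)); first exact: sqrtr_ge0.
apply: has_normal_law_add => //; first exact: measurable_funM.
move=> A C mA mC.
have maC : measurable ((fun x : R => a * x) @^-1` C).
  rewrite -[X in measurable X]setTI.
  have ma : measurable_fun setT (fun x : R => a * x) by exact: measurable_funM.
  exact: (ma measurableT C mC).
exact: (indep u v huv _ _ (pX A mA) maC).
Qed.

(** By induction on the latest times first: with [u >= v],
[a B_u + b B_v = a (B_u - B_v) + (a + b) B_v], and everything but the increment
is known at time [v]. Merging the coefficients this way makes repeated times
harmless. *)
Lemma has_normal_law_path_comb_sorted (ps : seq (R * R)) (a u : R) :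
  path (fun p q => q.2 <= p.2) (a, u) ps -> 0 <= u -> {in ps, forall p, 0 <= p.2} ->
  exists2 r, 0 <= r & has_normal_law P (path_comb ((a, u) :: ps)) 0 r.
Proof.
have [B0 _ _ _] := wB.
elim: ps a u => [|[b v] ps IH] a u /=.
  move=> _ u0 _.
  pose X w := a * B 0 w.
  have mX : measurable_fun setT X by exact: measurable_funM.
  have pX : past_measurable 0 X.
    rewrite (_ : X = path_comb [:: (a, 0)]); last first.
      by apply/funext => w; rewrite /path_comb big_seq1.
    by apply: past_measurable_path_comb => p; rewrite inE => /eqP ->/=; rewrite lexx.
  have hX : has_normal_law P X 0 0.
    apply: (has_normal_law_ae mX (measurable_cst (0 : R))) => //.
      by apply: filterS B0 => w; rewrite /X => ->; rewrite mulr0.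
    exact: has_normal_law_cst0.
  have h0u : (0 : R) <= 0 <= u by rewrite lexx.
  have [r r0 hr] := has_normal_law_add_increment a mX pX (lexx (0 : R)) hX h0u.
  exists r => //; rewrite (_ : path_comb _ = fun w => X w + a * increment B 0 u w)//.
  by apply/funext => w; rewrite /path_comb big_seq1 /X /increment/=; ring.
move=> /andP[vu pth] u0 H.
have v0 : 0 <= v by apply: (H (b, v)); rewrite mem_head.
have Hps : {in ps, forall p, 0 <= p.2} by move=> p pps; apply: H; rewrite inE pps orbT.
have pth' : path (fun p q : R * R => q.2 <= p.2) (a + b, v) ps.
  by case: ps pth {IH H Hps}.
have [s s0 hs] := IH (a + b) v pth' v0 Hps.
have pX : past_measurable v (path_comb ((a + b, v) :: ps)).
  apply: past_measurable_path_comb => p; rewrite inE => /predU1P[->/=|pps].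
    by rewrite v0 lexx.
  rewrite (Hps _ pps)/=.
  have tr : transitive (fun p q : R * R => q.2 <= p.2).
    by move=> x y z /= yx zx; exact: le_trans zx yx.
  by have /= := allP (order_path_min tr pth') p pps.
have huv : 0 <= v <= u by rewrite v0.
have [r r0 hr] := has_normal_law_add_increment a (measurable_path_comb _) pX s0 hs huv.
exists r => //; rewrite (_ : path_comb _ =
  fun w => path_comb ((a + b, v) :: ps) w + a * increment B v u w)//.
by apply/funext => w; rewrite /path_comb !big_cons /increment/=; ring.
Qed.

Lemma has_normal_law_path_comb (ps : seq (R * R)) : {in ps, forall p, 0 <= p.2} ->
  exists2 r, 0 <= r & has_normal_law P (path_comb ps) 0 r.
Proof.
move=> H; pose e (p q : R * R) := q.2 <= p.2.
have tot : total e by move=> p q; exact: le_total.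
have -> : path_comb ps = path_comb (sort e ps).
  by apply/funext => w; rewrite /path_comb; apply: perm_big; rewrite perm_sym perm_sort.
have := sort_sorted tot ps.
have : {in sort e ps, forall p, 0 <= p.2} by move=> p; rewrite mem_sort; exact: H.
case: (sort e ps) => [_ _|[a u] qs Hqs pth].
  exists 0 => //; rewrite (_ : path_comb _ = fun=> 0); first exact: has_normal_law_cst0.
  by apply/funext => w; rewrite /path_comb big_nil.
apply: has_normal_law_path_comb_sorted => //; first by apply: (Hqs (a, u));
  rewrite mem_head.
by move=> p pq; apply: Hqs; rewrite inE pq orbT.
Qed.

End wiener.

(** * Approximation by step processes *)

Section grid.
Context {R : realType}.

Definition grid (t : R) (n i : nat) : R := t * i%:R / n.+1%:R.

Lemma grid0 t n : grid t n 0 = 0.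
Proof. by rewrite /grid mulr0 mul0r. Qed.

Lemma gridn t n : grid t n n.+1 = t.
Proof. by rewrite /grid mulfK. Qed.

Lemma grid_le t n i j : 0 <= t -> (i <= j)%N -> grid t n i <= grid t n j.
Proof.
by move=> t0 ij; rewrite /grid ler_wpM2r ?invr_ge0// ler_wpM2l// ler_nat.
Qed.

Lemma grid_ge0 t n i : 0 <= t -> 0 <= grid t n i.
Proof. by move=> t0; rewrite -(grid0 t n) grid_le. Qed.

Lemma grid_let t n i : 0 <= t -> (i <= n.+1)%N -> grid t n i <= t.
Proof. by move=> t0 i_n; rewrite -[leRHS](gridn t n) grid_le. Qed.

Lemma gridS t n i : grid t n i.+1 - grid t n i = t / n.+1%:R.
Proof. by rewrite /grid -mulrBl -mulrBr -natr1 [_ + 1]addrC addrK mulr1. Qed.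

Lemma exists_cell (tau : nat -> R) (m : nat) (s : R) : tau 0%N < s <= tau m ->
  exists2 i, (i < m)%N & tau i < s <= tau i.+1.
Proof.
elim: m => [|m IH] /andP[s0 sm]; first by have := lt_le_trans s0 sm; rewrite ltxx.
have [ms|sm'] := ltP (tau m) s; first by exists m => //; rewrite ms.
have [|i im h] := IH; first by rewrite s0.
by exists i => //; exact: leqW.
Qed.

End grid.

Section step.
Context {d : measure_display} {T : measurableType d} {R : realType}.
Context {P : probability T R}.
Variable B : R -> {RV P >-> R}.

Lemma past_cst (s x : R) (C : set R) : past B s ((cst x : T -> R) @^-1` C).
Proof.
rewrite preimage_cst; case: ifPn => _;
  last exact: (@measurable0 _ (g_sigma_algebraType _)).
exact: (@measurableT _ (g_sigma_algebraType _)).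
Qed.

Definition step_process (t : R) (t0 : 0 <= t) (f : R -> R) (n : nat) :
  elementary_process B t.
refine (@ElementaryProcess _ _ _ _ B t n.+1 (grid t n)
  (fun i => (cst (f (grid t n i)) : {mfun T >-> R})) _ _ _ _ _).
- by rewrite grid0.
- by rewrite gridn.
- by move=> i _; rewrite grid_le.
- by move=> i _ C mC; exact: past_cst.
- by move=> i _; exists `|f (grid t n i)|.
Defined.

Definition step_sum (t : R) (f : R -> R) (n : nat) (w : T) : R :=
  \sum_(i < n.+1) f (grid t n i) * (B (grid t n i.+1) w - B (grid t n i) w).

Lemma step_sum_path_comb (t : R) (f : R -> R) (n : nat) : 0 <= t ->
  exists2 ps, {in ps, forall p, 0 <= p.2} & step_sum t f n = path_comb B ps.
Proof.
move=> t0.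
exists ([seq (f (grid t n i), grid t n i.+1) | i <- index_iota 0 n.+1] ++
        [seq (- f (grid t n i), grid t n i) | i <- index_iota 0 n.+1]).
  by move=> p; rewrite mem_cat => /orP[] /mapP[i _ ->] /=; exact: grid_ge0.
apply/funext => w; rewrite /path_comb; move Er : (index_iota _ _) => r.
rewrite big_cat /= !big_map -big_split /= -Er big_mkord; apply: eq_bigr => i _.
by rewrite /= mulrBr mulNr.
Qed.

(** On a cell of the grid the error is at most the increment of [f] over the cell,
which lies in [[0, 1]], so its square is at most that increment. Integrating and
telescoping bounds the squared distance by [t / n.+1], without any modulus of
continuity. *)
Lemma step_approximates (t : R) (t0 : 0 <= t) (f : R -> R) :
  measurable_fun `[0, t] f ->
  (forall x, 0 <= x <= t -> 0 <= f x <= 1) ->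
  (forall x y, 0 <= x -> x <= y -> y <= t -> f x <= f y) ->
  ep_approximates (step_process t0 f) f.
Proof.
move=> mf f01 f_nd.
pose val n (s : R) : R :=
  \sum_(i < n.+1) f (grid t n i) * \1_(`]grid t n i, grid t n i.+1]) s.
pose K n := (\int[lebesgue_measure]_(s in `[0%R, t]) ((val n s - f s) ^+ 2)%:E)%E.
have K0 n : (0 <= K n)%E by apply: integral_ge0 => s _; rewrite lee_fin sqr_ge0.
rewrite /ep_approximates.
rewrite (_ : (fun n => _) = K); last first.
  apply/funext => n; transitivity (\int[P]_w (cst (K n) w))%E.
    by apply: eq_integral => w _; apply: eq_integral => s _.
  by rewrite integral_cst// [X in (_ * X)%E]probability_setT mule1.
apply/ge0_cvge0P => // e e0.
have bound n : (K n <= (t / n.+1%:R)%:E)%E.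
  pose Del i := f (grid t n i.+1) - f (grid t n i).
  pose I i := `]grid t n i, grid t n i.+1]%classic.
  have Del0 i : (i < n.+1)%N -> 0 <= Del i.
    move=> i_n; rewrite subr_ge0; apply: f_nd; rewrite ?grid_ge0 ?grid_let//.
    exact: grid_le.
  have pt s : 0 <= s <= t -> (val n s - f s) ^+ 2 <=
      \1_[set 0] s + \sum_(i < n.+1) Del i * \1_(I i) s.
    (* the cells are open on the left: at 0 the step function vanishes while [f]
       need not, which the indicator of the null set [[set 0]] absorbs *)
    move=> /andP[]; rewrite le_eqVlt => /predU1P[<- _|s0 st].
      rewrite indicE mem_set//= /val big1 => [|i _]; last first.
        by rewrite indicE memNset ?mulr0// /= in_itv/= ltNge grid_ge0.
      rewrite sub0r sqrrN -[leLHS]addr0 lerD//.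
        have := f01 0; rewrite lexx t0 => /(_ isT)/andP[h0 h1].
        by rewrite expr_le1.
      by apply: sumr_ge0 => i _; rewrite mulr_ge0 ?Del0.
    have [|i i_n si] := @exists_cell R (grid t n) n.+1 s;
      first by rewrite grid0 gridn s0.
    pose i' := Ordinal i_n.
    have Ii : \1_(I i) s = 1 :> R by rewrite indicE mem_set.
    have other (j : 'I_n.+1) : j != i' -> \1_(I j) s = 0 :> R.
      move=> ji; rewrite indicE memNset// /I /= in_itv/=; apply/negP.
      case/andP: si => si1 si2; rewrite negb_and -leNgt -ltNge.
      move: ji; rewrite -(inj_eq val_inj)/= neq_ltn => /orP[ji|ij].
        by apply/orP; right; apply: le_lt_trans si1; exact: grid_le.
      by apply/orP; left; apply: (le_trans si2); exact: grid_le.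
    have -> : val n s = f (grid t n i).
      rewrite /val (bigD1 i')//= Ii mulr1 big1 ?addr0// => j ji.
      by rewrite other ?mulr0.
    rewrite (bigD1 i')//= Ii mulr1 big1 ?addr0; last first.
      by move=> j ji; rewrite other ?mulr0.
    apply: (@le_trans _ _ (Del i)); last by rewrite lerDr.
    case/andP: si => si1 si2.
    have gi0 := @grid_ge0 R t n i t0.
    have git := @grid_let R t n i.+1 t0 i_n.
    have fs0 : f (grid t n i) <= f s by apply: f_nd => //; exact: ltW.
    have fs1 : f s <= f (grid t n i.+1) by apply: f_nd => //; exact: ltW.
    have /andP[fg0 _] :=
      f01 (grid t n i) (introT andP (conj gi0 (le_trans (ltW si1) st))).
    have /andP[_ f1] := f01 s (introT andP (conj (ltW s0) st)).
    rewrite /Del -sqrrN opprB.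
    apply: (@le_trans _ _ (f s - f (grid t n i))); last by rewrite lerD2r.
    rewrite expr2 ler_piMr ?subr_ge0// lerBlDr.
    by rewrite (le_trans f1)// lerDl.
  have mIi i : measurable (I i : set (measurableTypeR R)) by exact: measurable_itv.
  have mI i : measurable_fun `[0, t] (fun s : R => (\1_(I i) s : R)%:E).
    by apply/measurable_EFinP; apply: measurable_indic; exact: measurable_itv.
  have mDI i : measurable_fun `[0, t] (fun s : R => (Del i)%:E * (\1_(I i) s)%:E)%E.
    exact: emeasurable_funM.
  apply: (@le_trans _ _ (\int[lebesgue_measure]_(s in `[0%R, t])
     ((\1_[set 0] s)%:E + \sum_(i < n.+1) (Del i)%:E * (\1_(I i) s)%:E))%E).
    apply: ge0_le_integral => //.
    - by move=> s _; rewrite lee_fin sqr_ge0.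
    - apply/measurable_EFinP/measurable_funX/measurable_funB => //.
      apply: measurable_sum => i; exact: measurable_funM.
    - apply: emeasurable_funD; first exact/measurable_EFinP/measurable_indic.
      by apply: emeasurable_sum => i; exact: mDI.
    - move=> s /=; rewrite in_itv/= => st.
      under eq_bigr do rewrite -EFinM.
      by rewrite sumEFin -EFinD lee_fin; exact: pt.
  have I0 i (s : R) : (i < n.+1)%N -> (0 <= (Del i)%:E * (\1_(I i) s)%:E)%E.
    by move=> i_n; rewrite -EFinM lee_fin mulr_ge0 ?Del0.
  rewrite ge0_integralD; last 5 first.
  - exact: measurable_itv.
  - by move=> s _; rewrite lee_fin.
  - exact/measurable_EFinP/measurable_indic.
  - by move=> s _; apply: sume_ge0 => i _; exact: I0.
  - by apply: emeasurable_sum => i; exact: mDI.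
  rewrite integral_indic ?measurable_itv//.
  rewrite ge0_integral_sum; last 3 first.
  - exact: measurable_itv.
  - by move=> i; exact: mDI.
  - by move=> i s _; exact: I0.
  rewrite [X in (X + _ <= _)%E](_ : _ = 0%E); last first.
    apply/eqP; rewrite eq_le measure_ge0 andbT.
    rewrite -(lebesgue_measure_set1 (0 : R)); apply: le_measure; rewrite ?inE//.
    by apply: measurableI.
  rewrite add0e.
  apply: (@le_trans _ _ (\sum_(i < n.+1) (Del i)%:E * (t / n.+1%:R)%:E)%E).
    apply: lee_sum => i _.
    rewrite ge0_integralZl; last 4 first.
    - exact: measurable_itv.
    - exact: mI.
    - by move=> s _; rewrite lee_fin.
    - by rewrite lee_fin Del0.
    apply: lee_wpmul2l; first by rewrite lee_fin Del0.
    rewrite integral_indic; [|exact: measurable_itv|exact: mIi].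
    apply: (@le_trans _ _ (lebesgue_measure (I i))).
      apply: le_measure; rewrite ?inE; [|exact: mIi|exact: subIsetl].
      by apply: measurableI; [exact: mIi|exact: measurable_itv].
    rewrite lebesgue_measure_itv/= -(gridS t n i) -EFinB; case: ifPn => // _.
    by rewrite lee_fin subr_ge0 grid_le.
  under eq_bigr do rewrite -EFinM.
  rewrite sumEFin lee_fin -mulr_suml ler_piMl ?divr_ge0//.
  rewrite -(big_mkord xpredT Del) telescope_sumr// grid0 gridn.
  have /andP[_ ft] := f01 t (introT andP (conj t0 (lexx t))).
  have /andP[f00 _] := f01 0 (introT andP (conj (lexx 0) t0)).
  by rewrite lerBlDr (le_trans ft)// lerDl.
near=> n; apply: (le_trans (bound n)); rewrite lee_fin.
rewrite ler_pdivrMr// mulrC -ler_pdivrMr//.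
rewrite (@le_trans _ _ n%:R)// ?ler_nat//; near: n; exact: nbhs_infty_ger.
Unshelve. all: by end_near. Qed.

End step.

Section l2_sum.
Context {d : measure_display} {T : measurableType d} {R : realType}.
Variable P : probability T R.

Lemma l2_cvgP (Z : nat -> T -> R) (X : T -> R) :
  l2_cvg P Z X <-> forall e : R, 0 < e ->
    \forall n \near \oo, (\int[P]_w ((Z n w - X w) ^+ 2)%:E <= e%:E)%E.
Proof.
by apply: ge0_cvge0P => n; apply: integral_ge0 => w _; rewrite lee_fin sqr_ge0.
Qed.

(** This follows from [(u + c v)^2 <= 2 u^2 + 2 c^2 v^2]. *)
Lemma l2_cvg_add (Z Z' : nat -> T -> R) (X X' : T -> R) (c : R) :
  (forall n, measurable_fun setT (Z n)) -> (forall n, measurable_fun setT (Z' n)) ->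
  measurable_fun setT X -> measurable_fun setT X' ->
  l2_cvg P Z X -> l2_cvg P Z' X' ->
  l2_cvg P (fun n w => Z n w + c * Z' n w) (fun w => X w + c * X' w).
Proof.
move=> mZ mZ' mX mX' /l2_cvgP ZX /l2_cvgP ZX'; apply/l2_cvgP => e e0.
pose q := c ^+ 2 + 1.
have q0 : 0 < q by rewrite ltr_wpDl ?sqr_ge0.
have e40 : 0 < e / 4 by rewrite divr_gt0.
have eq0 : 0 < e / 4 / q by rewrite divr_gt0.
near=> n.
have H1 : (\int[P]_w ((Z n w - X w) ^+ 2)%:E <= (e / 4)%:E)%E by near: n; exact: ZX.
have H2 : (\int[P]_w ((Z' n w - X' w) ^+ 2)%:E <= (e / 4 / q)%:E)%E.
  by near: n; exact: ZX'.
have s0 (U V : T -> R) w : (0 <= ((U w - V w) ^+ 2)%:E)%E by rewrite lee_fin sqr_ge0.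
have m1 := measurable_sqrB (mZ n) mX.
have m2 := measurable_sqrB (mZ' n) mX'.
apply: (@le_trans _ _ (\int[P]_w (2%:E * ((Z n w - X w) ^+ 2)%:E +
    (2 * c ^+ 2)%:E * ((Z' n w - X' w) ^+ 2)%:E))%E).
  apply: ge0_le_integral.
  - exact: measurableT.
  - by move=> w _; rewrite lee_fin sqr_ge0.
  - by apply: measurable_sqrB; apply: measurable_funD => //; exact: measurable_funM.
  - by apply: emeasurable_funD; exact: emeasurable_funM.
  - move=> w _; rewrite -!EFinM -EFinD lee_fin -subr_ge0.
    rewrite (_ : _ - _ = (Z n w - X w - c * (Z' n w - X' w)) ^+ 2) ?sqr_ge0//.
    by ring.
rewrite ge0_integralD; last 5 first.
- exact: measurableT.
- by move=> w _; rewrite mule_ge0.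
- exact: emeasurable_funM.
- by move=> w _; rewrite mule_ge0// lee_fin mulr_ge0 ?sqr_ge0.
- exact: emeasurable_funM.
rewrite ge0_integralZl;
  [|exact: measurableT|exact: m1|by move=> w _|by rewrite lee_fin].
rewrite ge0_integralZl;
  [|exact: measurableT|exact: m2|by move=> w _|by rewrite lee_fin mulr_ge0 ?sqr_ge0].
apply: (@le_trans _ _ (2%:E * (e / 4)%:E + (2 * c ^+ 2)%:E * (e / 4 / q)%:E)%E).
  apply: leeD; apply: lee_wpmul2l => //.
  by rewrite lee_fin mulr_ge0 ?sqr_ge0.
rewrite -!EFinM -EFinD lee_fin.
have H3 : c ^+ 2 / q <= 1 by rewrite ler_pdivrMr// mul1r lerDl.
rewrite (_ : 2 * c ^+ 2 * (e / 4 / q) = e / 2 * (c ^+ 2 / q)); last by field;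
  rewrite gt_eqF.
rewrite (_ : 2 * (e / 4) = e / 2); last by field.
rewrite {3}(_ : e = e / 2 + e / 2); last by field.
by rewrite lerD2l ler_piMr// divr_ge0// ltW.
Unshelve. all: by end_near. Qed.

Lemma l2_cvg_sum (n : nat) (c : 'I_n -> R) (Z : 'I_n -> nat -> T -> R) (X :
  'I_n -> T -> R) :
  (forall i k, measurable_fun setT (Z i k)) -> (forall i, measurable_fun setT (X i)) ->
  (forall i, l2_cvg P (Z i) (X i)) ->
  l2_cvg P (fun k w => \sum_(i < n) c i * Z i k w) (fun w => \sum_(i < n) c i * X i w).
Proof.
elim: n c Z X => [|n IH] c Z X mZ mX ZX.
  apply/l2_cvgP => e e0; apply: nearW => k.
  under eq_integral do rewrite !big_ord0 subrr expr0n.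
  by rewrite integral0 lee_fin ltW.
have := l2_cvg_add (c ord_max) _ (mZ ord_max) _ (mX ord_max)
  (IH (fun i => c (widen_ord (leqnSn n) i)) (fun i => Z (widen_ord (leqnSn n) i))
     (fun i => X (widen_ord (leqnSn n) i)) (fun i => mZ _) (fun i => mX _)
       (fun i => ZX _)) (ZX ord_max).
rewrite /l2_cvg.
under [in X in _ -> X]eq_fun do under eq_integral do rewrite !big_ord_recr/=.
apply.
- by move=> k; apply: measurable_sum => i; exact: measurable_funM.
- by apply: measurable_sum => i; exact: measurable_funM.
Qed.

End l2_sum.

Section wiener_integrals.
Context {d : measure_display} {T : measurableType d} {R : realType}.
Context {P : probability T R}.
Variable B : R -> {RV P >-> R}.

Lemma ito_integral_l2_cvg (t : R) (f : R -> R) (X : {RV P >-> R}) : 0 <= t ->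
  (forall x, 0 <= x <= t -> 0 <= f x <= 1) ->
  (forall x y, 0 <= x -> x <= y -> y <= t -> f x <= f y) ->
  ito_integral B t f X -> l2_cvg P (step_sum B t f) X.
Proof.
move=> t0 f01 fnd [mf _ H].
exact: (H _ (step_approximates B t0 mf f01 fnd)).
Qed.

Lemma sum_path_comb (n : nat) (c : 'I_n -> R) (ps : 'I_n -> seq (R * R)) :
  (fun w => \sum_(i < n) c i * path_comb B (ps i) w) =
  path_comb B (flatten [seq [seq (c i * p.1, p.2) | p <- ps i] | i <- enum 'I_n]).
Proof.
apply/funext => w; rewrite /path_comb big_flatten big_map big_enum /=.
apply: eq_bigr => i _; rewrite big_map mulr_sumr.
by apply: eq_bigr => p _; rewrite mulrA.
Qed.

Lemma has_normal_law_limit_path_comb (n : nat) (c : 'I_n -> R) (X : 'I_n -> T -> R) :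
  wiener_process B -> (forall i, measurable_fun setT (X i)) ->
  (forall i, exists2 ps : nat -> seq (R * R),
     (forall k, {in ps k, forall p, 0 <= p.2}) &
     l2_cvg P (fun k => path_comb B (ps k)) (X i)) ->
  exists2 s, 0 <= s & has_normal_law P (fun w => \sum_(i < n) c i * X i w) 0 s.
Proof.
move=> wB mX HX.
pose Q i (ps : nat -> seq (R * R)) := (forall k, {in ps k, forall p, 0 <= p.2}) /\
  l2_cvg P (fun k => path_comb B (ps k)) (X i).
have /choice[ps Hps] : forall i, exists ps, Q i ps.
  by move=> i; have [ps ps1 ps2] := HX i; exists ps.
pose qs k := flatten [seq [seq (c i * p.1, p.2) | p <- ps i k] | i <- enum 'I_n].
have Hqs k : {in qs k, forall p, 0 <= p.2}.
  move=> p /flattenP[/= r /mapP[i _ ->]] /mapP[q qr ->] /=.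
  by have [H _] := Hps i; exact: (H k q qr).
have /choice[s Hs] :
  forall k, exists s, 0 <= s /\ has_normal_law P (path_comb B (qs k)) 0 s.
  by move=> k; have [s s0 hs] := has_normal_law_path_comb wB (Hqs k); exists s.
apply: (@has_normal_law_l2_limit _ _ _ P (fun k => path_comb B (qs k)) s).
- by move=> k; exact: measurable_path_comb.
- by apply: measurable_sum => i; exact: measurable_funM.
- by move=> k; have [] := Hs k.
- by move=> k; have [] := Hs k.
- rewrite (_ : (fun k => _) =
    (fun k w => \sum_(i < n) c i * path_comb B (ps i k) w)); last first.
    by apply/funext => k; rewrite sum_path_comb.
  apply: l2_cvg_sum => //.
  + by move=> i k; exact: measurable_path_comb.
  + by move=> i; have [] := Hps i.
Qed.

End wiener_integrals.

(** * The integrand *)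

Section bridge_kernel.
Context {R : realType}.
Variables (T alpha t : R).
Hypotheses (alpha_gt0 : 0 < alpha) (t0 : 0 <= t) (tT : t < T).

Lemma bridge_kernel01 (x : R) : 0 <= x <= t ->
  0 <= ((T - t) / (T - x)) `^ alpha <= 1.
Proof.
move=> /andP[x0 xt]; rewrite powR_ge0/=.
have <- : 1 `^ alpha = 1 :> R by rewrite powR1.
have Tx : 0 < T - x by rewrite subr_gt0 (le_lt_trans xt).
have Tt : 0 <= T - t by rewrite subr_ge0 ltW.
apply: ge0_ler_powR; rewrite ?nnegrE ?divr_ge0 ?(ltW alpha_gt0) ?(ltW Tx)//.
by rewrite ler_pdivrMr// mul1r lerD2l lerN2.
Qed.

Lemma bridge_kernel_nd (x y : R) : 0 <= x -> x <= y -> y <= t ->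
  ((T - t) / (T - x)) `^ alpha <= ((T - t) / (T - y)) `^ alpha.
Proof.
move=> x0 xy yt.
have Ty : 0 < T - y by rewrite subr_gt0 (le_lt_trans yt).
have Tx : 0 < T - x by rewrite subr_gt0 (le_lt_trans xy)// (le_lt_trans yt).
have Tt : 0 <= T - t by rewrite subr_ge0 ltW.
apply: ge0_ler_powR; rewrite ?nnegrE ?divr_ge0 ?(ltW alpha_gt0) ?(ltW Tx) ?(ltW Ty)//.
by rewrite ler_wpM2l// lef_pV2 ?posrE// lerD2l lerN2.
Qed.

End bridge_kernel.

(** * Continuity of the paths *)

Section ae_limit.
Context {d : measure_display} {T : measurableType d} {R : realType}.
Variable P : probability T R.

(** Almost surely some term of the sequence is arbitrarily close to the limit. This is
weaker than the convergence of a subsequence but transfers any bound that holds for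
all [Z n w], and it only needs the Markov inequality: the event that every [Z n]
stays away from [X] is null. *)
Lemma l2_cvg_ae_close (Z : nat -> T -> R) (X : T -> R) :
  (forall n, measurable_fun setT (Z n)) -> measurable_fun setT X ->
  l2_cvg P Z X ->
  {ae P, forall w, forall e : R, 0 < e -> exists n, `|Z n w - X w| < e}.
Proof.
move=> mZ mX /l2_cvgP ZX.
pose far k := \bigcap_n [set w | (k.+1%:R^-1%:E <= ((Z n w - X w) ^+ 2)%:E)%E].
have mD n := measurable_sqrB (mZ n) mX.
have mfar_n k n : measurable [set w | (k.+1%:R^-1%:E <= ((Z n w - X w) ^+ 2)%:E)%E].
  rewrite -[X in measurable X]setTI; exact: emeasurable_fun_c_infty.
have mfar k : measurable (far k) by apply: bigcap_measurable.
have far0 k : P (far k) = 0%E.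
  have c0 : 0 < k.+1%:R^-1 :> R by rewrite invr_gt0.
  apply/eqP; rewrite eq_le measure_ge0 andbT; apply/lee_addgt0Pr => e e0; rewrite add0e.
  have [N _ /(_ N (leqnn N))/= H] := ZX (k.+1%:R^-1 * e) (mulr_gt0 c0 e0).
  rewrite -(@lee_pmul2l _ k.+1%:R^-1%:E)//.
  rewrite -EFinM; apply: le_trans H.
  have -> : (k.+1%:R^-1%:E * P (far k) = \int[P]_w (k.+1%:R^-1 * \1_(far k) w)%:E)%E.
    under eq_integral do rewrite EFinM.
    rewrite ge0_integralZl; last 4 first.
    - exact: measurableT.
    - exact/measurable_EFinP/measurable_indic.
    - by move=> w _; rewrite lee_fin.
    - by rewrite lee_fin ltW.
    by rewrite integral_indic// setIT.
  apply: ge0_le_integral.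
  - exact: measurableT.
  - by move=> w _; rewrite lee_fin mulr_ge0// ltW.
  - by apply/measurable_EFinP; exact: measurable_funM.
  - exact: mD.
  - move=> w _; rewrite indicE; case: (boolP (w \in far k)) => [|_].
      by rewrite inE => /(_ N I)/=; rewrite mulr1.
    by rewrite mulr0 lee_fin sqr_ge0.
have : P.-negligible (\bigcup_k far k).
  apply: negligible_bigcup => k.
  by exists (far k); split; [exact: mfar|exact: far0|].
apply: negligibleS => w /= /existsNP[e] /not_implyP[e0] /forallNP H.
have [k _ ke] : exists2 k, True & k.+1%:R^-1 <= e ^+ 2.
  exists (Num.trunc (e ^+ 2)^-1) => //.
  rewrite -[leRHS]invrK lef_pV2 ?posrE ?invr_gt0 ?exprn_gt0//.
  by rewrite ltW// truncnS_gt.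
exists k => // n _ /=; rewrite lee_fin (le_trans ke)//.
have /negP := H n; rewrite -leNgt => He.
by rewrite -[leRHS]real_normK ?num_real// lerXn2r ?nnegrE// ltW.
Qed.

End ae_limit.

Section summation_by_parts.
Context {R : realType}.

Lemma sum_by_parts (a b : nat -> R) (m : nat) :
  \sum_(i < m) a i * (b i.+1 - b i) =
  a 0%N * (b m - b 0%N) + \sum_(i < m) (b m - b i.+1) * (a i.+1 - a i).
Proof.
pose u i := a i * (b i - b m).
have -> : a 0%N * (b m - b 0%N) = \sum_(0 <= i < m) (u i.+1 - u i).
  by rewrite telescope_sumr// /u subrr mulr0 sub0r -mulrN opprB.
rewrite big_mkord -big_split/=; apply: eq_bigr => i _; rewrite /u; ring.
Qed.

(** After summation by parts the increments of [a] are the weights of the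
differences [b m - b i.+1]. Where [a] exceeds [c] the differences are at most [e]
and the weights add up to at most 1. Below [c] the differences are at most [M], and
the weights, which are the increments of [min (a i) c], add up to at most [c].
  The boundary
term [a 0 * (b m - b 0)] accounts for another [M * c]. *)
Lemma sum_by_parts_bound (a b : nat -> R) (m : nat) (M e c : R) : 0 <= e -> 0 <= c ->
  (forall i j, (i <= j <= m)%N -> a i <= a j) -> 0 <= a 0%N -> a m <= 1 ->
  (forall i, (i <= m)%N -> `|b m - b i| <= M) ->
  (forall i, (i < m)%N -> c < a i.+1 -> `|b m - b i.+1| <= e) ->
  a 0%N <= c ->
  `|\sum_(i < m) a i * (b i.+1 - b i)| <= e + M * c *+ 2.
Proof.
move=> e0 c0 a_nd a0 am bM be a0c.
have M0 : 0 <= M by apply: le_trans (bM 0%N (leq0n m)).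
rewrite sum_by_parts (le_trans (ler_normD _ _))//.
rewrite mulr2n addrCA; apply: lerD.
  rewrite normrM (ger0_norm a0) mulrC; apply: ler_pM => //; exact: bM.
apply: (le_trans (ler_norm_sum _ _ _)).
pose mi i := Num.min (a i) c.
apply: (@le_trans _ _ (\sum_(i < m) (e * (a i.+1 - a i) + M * (mi i.+1 - mi i)))).
  apply: ler_sum => i _.
  have ai : a i <= a i.+1 by apply: a_nd; rewrite leqnSn/=.
  rewrite normrM [`|a _ - _|]ger0_norm ?subr_ge0//.
  have [ca|ac] := ltP c (a i.+1).
    rewrite -[leLHS]addr0 lerD//.
      by rewrite ler_wpM2r ?subr_ge0// be.
    by rewrite mulr_ge0// subr_ge0 /mi le_min !ge_min ai lexx orbT.
  have aic := le_trans ai ac.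
  rewrite /mi !min_l// -[leLHS]add0r lerD ?mulr_ge0 ?subr_ge0//.
  by rewrite ler_wpM2r ?subr_ge0// bM.
rewrite big_split/= -!mulr_sumr.
rewrite -(big_mkord xpredT (fun i => a i.+1 - a i)) -(big_mkord xpredT (fun i =>
  mi i.+1 - mi i)).
rewrite !telescope_sumr//; apply: lerD.
  by rewrite ler_piMr// lerBlDr (le_trans am)// lerDl.
rewrite ler_wpM2l// lerBlDr /mi (@le_trans _ _ c)// ?ge_min ?lexx ?orbT//.
by rewrite lerDl le_min a0.
Qed.

End summation_by_parts.

Section path.
Context {R : realType}.

Lemma within_continuous_dist_le (A : set R) (f : R -> R) (x e : R) :
  {within A, continuous f} -> A x -> 0 < e ->
  exists2 del, 0 < del & forall y, A y -> `|x - y| < del -> `|f x - f y| <= e.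
Proof.
move=> /subspace_continuousP /(_ x) cf Ax e0.
have /cvgrPdist_le/(_ _ e0) := cf Ax.
by move=> [del /= del0 H]; exists del => // y Ay xy; exact: H.
Qed.

Lemma within_continuous_oscillation_le (a c : R) (f : R -> R) : a <= c ->
  {within `[a, c], continuous f} ->
  exists2 M, 0 < M & forall x y, a <= x <= c -> a <= y <= c -> `|f x - f y| <= M.
Proof.
move=> ac cf.
have [u _ fu] := EVT_max ac cf.
have [v _ fv] := EVT_min ac cf.
exists (`|f u - f v| + 1); first by rewrite ltr_wpDl.
move=> x y xac yac.
have ux := fu x xac; have uy := fu y yac; have vx := fv x xac; have vy := fv y yac.
apply: (@le_trans _ _ (f u - f v)).
  by rewrite ler_norml; apply/andP; split; lra.
by rewrite (le_trans (ler_norm _))// lerDl.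
Qed.

Variables (T alpha : R).
Hypotheses (T_gt0 : 0 < T) (alpha_gt0 : 0 < alpha).
Let K (t s : R) := ((T - t) / (T - s)) `^ alpha.

Lemma bridge_kernel_le_left (r t q : R) : r < T -> t <= q -> q < T -> K q r <= K t r.
Proof.
move=> rT tq qT; have Tr : 0 < T - r by rewrite subr_gt0.
have Tq : 0 <= T - q by rewrite subr_ge0 ltW.
have Tt : 0 <= T - t by rewrite subr_ge0 ltW// (le_lt_trans tq).
apply: ge0_ler_powR; rewrite ?nnegrE ?divr_ge0 ?(ltW alpha_gt0) ?(ltW Tr)//.
by rewrite ler_pM2r ?invr_gt0// lerD2l lerN2.
Qed.

(** With [c = K t r], the grid points where the kernel exceeds [c] lie after [r],
where the path oscillates by at most [e]. *)
Lemma step_bound (b : R -> R) (M e r t : R) (n : nat) : 0 <= r -> r <= t -> t < T ->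
  0 <= e ->
  (forall x y, 0 <= x <= T -> 0 <= y <= T -> `|b x - b y| <= M) ->
  (forall x y, r <= x <= T -> r <= y <= T -> `|b x - b y| <= e) ->
  `|\sum_(i < n.+1) K t (grid t n i) * (b (grid t n i.+1) - b (grid t n i))| <=
  e + M * K t r *+ 2.
Proof.
move=> r0 rt tT e0 bM be.
have t0 := le_trans r0 rt.
apply: (sum_by_parts_bound (a := fun i => K t (grid t n i))
  (b := fun i => b (grid t n i))) => //=.
- exact: powR_ge0.
- move=> i j /andP[ij jn]; apply: bridge_kernel_nd => //.
  + exact: grid_ge0.
  + exact: grid_le.
  + exact: grid_let.
- exact: powR_ge0.
- by rewrite gridn;
    have /andP[] := bridge_kernel01 alpha_gt0 tT (introT andP (conj t0 (lexx t))).
- move=> i i_n; apply: bM; rewrite ?gridn ?t0 ?(ltW tT)// grid_ge0//=.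
  by rewrite (le_trans (grid_let t0 i_n))// ltW.
- move=> i i_n cK; apply: be; first by rewrite gridn rt ltW.
  rewrite (le_trans (grid_let t0 i_n)) ?(ltW tT)// andbT leNgt; apply/negP => gr.
  move: cK; rewrite ltNge => /negP; apply; apply: bridge_kernel_nd => //.
  + exact: grid_ge0.
  + exact: ltW.
- by rewrite grid0; apply: bridge_kernel_nd.
Qed.

(** The bound of [step_bound] holds for [y] at rational times, hence at all times
of [[r, T[] because [K] decreases in its first argument. Near [T], choose [r]
from the continuity of [b] at [T], then let [t] tend to [T]. *)
Lemma bridge_path_continuous (b y : R -> R) :
  {within `[0, +oo[, continuous b} -> {within `[0, T[, continuous y} -> y T = 0 ->
  (forall q : rat, 0 <= (ratr q : R) < T -> forall e : R, 0 < e -> exists n,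
    `|\sum_(i < n.+1) K (ratr q) (grid (ratr q) n i) *
       (b (grid (ratr q) n i.+1) - b (grid (ratr q) n i)) - y (ratr q)| < e) ->
  {within `[0, T], continuous y}.
Proof.
move=> cb cy yT Hq.
have cbT : {within `[0, T], continuous b}.
  by apply: continuous_subspaceW cb => x /=; rewrite !in_itv/= andbT => /andP[].
have [M M0 bM] := within_continuous_oscillation_le (ltW T_gt0) cbT.
have y_bound r e t : 0 <= r -> r <= t -> t < T -> 0 <= e ->
    (forall x y, r <= x <= T -> r <= y <= T -> `|b x - b y| <= e) ->
    `|y t| <= e + M * K t r *+ 2.
  move=> r0 rt tT e0 be; apply/ler_addgt0Pr => h h0.
  have h20 : 0 < h / 2 by rewrite divr_gt0.
  have t0 := le_trans r0 rt.
  have yt : `[0, T[%classic t by rewrite /= in_itv/= t0.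
  have [del del0 Hdel] := within_continuous_dist_le cy yt h20.
  have tm : t < Num.min T (t + del) by rewrite lt_min tT ltrDl.
  have [q] := rat_in_itvoo tm; rewrite in_itv/= lt_min => /and3P[tq qT qdel].
  have q0 : 0 <= ratr q :> R by rewrite (le_trans t0)// ltW.
  have rq : r <= ratr q by rewrite (le_trans rt)// ltW.
  have H1 : `|y t - y (ratr q)| <= h / 2.
    apply: Hdel; first by rewrite /= in_itv/= q0.
    by rewrite distrC gtr0_norm ?subr_gt0// ltrBlDl.
  have [n Hn] := Hq q (introT andP (conj q0 qT)) _ h20.
  have H2 := @step_bound b M e r (ratr q) n r0 rq qT e0 bM be.
  have H3 : M * K (ratr q) r <= M * K t r.
    rewrite ler_wpM2l ?(ltW M0)//; apply: bridge_kernel_le_left => //.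
      exact: le_lt_trans rq qT.
    exact: ltW.
  set S := \sum_(i < n.+1) _ in Hn H2.
  have -> : y t = (y t - y (ratr q)) + - (S - y (ratr q)) + S by ring.
  apply: (le_trans (ler_normD _ _)).
  rewrite [leRHS](_ : _ = (h / 2 + h / 2) + (e + M * K t r *+ 2)); last by field.
  apply: lerD; last by rewrite (le_trans H2)// lerD2l ler_wMn2r.
  by rewrite (le_trans (ler_normD _ _))// normrN lerD// ltW.
apply/subspace_continuousP => x /=; rewrite in_itv/= => /andP[x0].
rewrite le_eqVlt => /predU1P[->|xT]; apply/cvgrPdist_le => e e0;
  rewrite /from_subspace /=.
- rewrite yT.
  have e20 : 0 < e / 4 by rewrite divr_gt0.
  have e40 : 0 < e / 2 by rewrite divr_gt0.
  have TT : `[0, +oo[%classic T by rewrite /= in_itv/= ltW.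
  have [del del0 Hdel] := within_continuous_dist_le cb TT e20.
  pose r := Num.max 0 (T - del / 2).
  have r0 : 0 <= r by rewrite /r le_max lexx.
  have rT : r < T by rewrite /r gt_max T_gt0/= gtrBl divr_gt0.
  have be u v : r <= u <= T -> r <= v <= T -> `|b u - b v| <= e / 2.
    move=> /andP[ru uT] /andP[rv vT].
    have close z : r <= z -> z <= T -> `|b T - b z| <= e / 4.
      move=> rz zT; apply: Hdel; first by rewrite /= in_itv/= (le_trans r0).
      rewrite ger0_norm ?subr_ge0//.
      have : T - del / 2 <= r by rewrite /r le_max lexx orbT.
      by move: rz del0; lra.
    rewrite (_ : b u - b v = - (b T - b u) + (b T - b v)); last by ring.
    rewrite (le_trans (ler_normD _ _))// normrN.
    by have := close u ru uT; have := close v rv vT; lra.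
  (* [c] is the value below which [K z r] makes the second term at most [e / 2];
     solving [((T - z) / (T - r)) `^ alpha <= c] for [z] gives [del'] *)
  pose c := e / (4 * M).
  have c0 : 0 < c by rewrite divr_gt0// mulr_gt0.
  have Tr : 0 < T - r by rewrite subr_gt0.
  pose del' := Num.min (T - r) ((T - r) * c `^ (alpha^-1)).
  have del'0 : 0 < del' by rewrite lt_min Tr mulr_gt0// powR_gt0.
  exists del' => //= z zdel; rewrite in_itv/= => /andP[z0].
  rewrite sub0r normrN le_eqVlt => /predU1P[->|zT]; first by rewrite yT normr0 ltW.
  have Tz : 0 < T - z by rewrite subr_gt0.
  move: zdel; rewrite /= gtr0_norm// lt_min => /andP[z1 z2].
  have rz : r <= z by rewrite -(lerN2 z) -(lerD2l T) ltW.
  apply: (le_trans (y_bound r (e / 2) z r0 rz zT (ltW e40) be)).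
  rewrite [leRHS](_ : e = e / 2 + (e / 4) *+ 2); last by field.
  rewrite lerD2l ler_wMn2r//.
  rewrite mulrC -ler_pdivlMr// (_ : e / 4 / M = c); last by rewrite /c; field;
    rewrite gt_eqF.
  have -> : c = (c `^ alpha^-1) `^ alpha.
    by rewrite -powRrM mulVf ?gt_eqF// powRr1 ?ltW.
  apply: ge0_ler_powR;
    rewrite ?nnegrE ?powR_ge0 ?divr_ge0 ?(ltW Tz) ?(ltW Tr) ?(ltW alpha_gt0)//.
  by rewrite ler_pdivrMr// mulrC ltW.
- have xx : `[0, T[%classic x by rewrite /= in_itv/= x0.
  have [del del0 Hdel] := within_continuous_dist_le cy xx e0.
  exists (Num.min del (T - x)) => /=; first by rewrite lt_min del0 subr_gt0.
  move=> z; rewrite /= lt_min => /andP[zdel zT]; rewrite in_itv/= => /andP[z0 _].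
  apply: Hdel => //; rewrite /= in_itv/= z0/=.
  by move: zT; rewrite ltr_norml => /andP[+ _]; lra.
Qed.

End path.

(** * The process *)

Theorem lemma3p1 (R : realType) (d : measure_display)
    (Omega : measurableType d) (P : probability Omega R)
    (T alpha : R) (T_gt0 : 0 < T) (alpha_gt0 : 0 < alpha)
    (B : R -> {RV P >-> R}) (wienerB : wiener_process B)
    (Y : R -> {RV P >-> R})
    (Y_integral : forall t : R, 0 <= t < T ->
       ito_integral B t (fun s => ((T - t) / (T - s)) `^ alpha) (Y t))
    (Y_continuous : ae_continuous_paths `[0, T[ Y)
    (Y_T : forall w, Y T w = 0) :
  [/\ centered_process `[0, T] Y,
      gaussian_process `[0, T] Y &
      ae_continuous_paths `[0, T] Y].
Proof.
pose K t s := ((T - t) / (T - s)) `^ alpha.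
have Ystep t : 0 <= t < T -> l2_cvg P (step_sum B t (K t)) (Y t).
  move=> t0T; have /andP[t0 tT] := t0T.
  apply: ito_integral_l2_cvg => //; last exact: Y_integral.
  - by move=> x; exact: bridge_kernel01.
  - by move=> x y; exact: bridge_kernel_nd.
have Ycomb t : `[0, T]%classic t -> exists2 ps : nat -> seq (R * R),
    (forall k, {in ps k, forall p, 0 <= p.2}) &
    l2_cvg P (fun k => path_comb B (ps k)) (Y t).
  rewrite /= in_itv/= => /andP[t0]; rewrite le_eqVlt => /predU1P[->|tT].
    exists (fun=> [::]) => //; apply/l2_cvgP => e e0; apply: nearW => k.
    under eq_integral do rewrite /path_comb big_nil Y_T subrr expr0n.
    by rewrite integral0 lee_fin ltW.
  have /choice[ps Hps] : forall k, exists ps, {in ps, forall p : R * R, 0 <= p.2} /\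
      step_sum B t (K t) k = path_comb B ps.
    by move=> k; have [ps ps1 ps2] := step_sum_path_comb B (K t) k t0; exists ps.
  exists ps; first by move=> k; have [] := Hps k.
  rewrite (_ : (fun k => _) = step_sum B t (K t)); first by apply: Ystep; rewrite t0.
  by apply/funext => k; have [_ ->] := Hps k.
have Ynormal (n : nat) (t : 'I_n -> R) (c : 'I_n -> R) :
  (forall i, `[0, T]%classic (t i)) ->
    exists2 s, 0 <= s & has_normal_law P (fun w => \sum_(i < n) c i * Y (t i) w) 0 s.
  move=> tT.
  by apply: (has_normal_law_limit_path_comb (X :=
    fun i => Y (t i)) c wienerB) => // i; exact: Ycomb.
split.
- move=> t tT; rewrite expectation_def.
  have [s s0] := Ynormal 1%N (fun=> t) (fun=> 1) (fun=> tT).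
  rewrite (_ : (fun w => _) = Y t); last first.
    by apply/funext => w; rewrite big_ord1 mul1r.
  by move=> hs; apply: integral_normal_law_eq0 hs.
- move=> n t tT c; have [s s0 hs] := Ynormal n t c tT.
  by exists 0, s.
have [_ _ _ Bcont] := wienerB.
pose rat_of n : rat := odflt 0 (unpickle n).
have close : {ae P, forall w, forall n, 0 <= (ratr (rat_of n) : R) < T ->
    forall e : R, 0 < e -> exists k,
    `|step_sum B (ratr (rat_of n))
      (K (ratr (rat_of n))) k w - Y (ratr (rat_of n)) w| < e}.
  apply/ae_foralln => n.
  have [qT|qT] := boolP (0 <= (ratr (rat_of n) : R) < T); last by apply: aeW => w.
  have mS k : measurable_fun setT (step_sum B (ratr (rat_of n))
    (K (ratr (rat_of n))) k).
    by apply: measurable_sum => i; apply: measurable_funM => //; exact: measurable_funB.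
  have /= H := l2_cvg_ae_close mS (@measurable_funPT _ _ _ _ (Y (ratr (rat_of
    n)))) (Ystep _ qT).
  by apply: filterS H => w Hw _.
rewrite /ae_continuous_paths.
apply: filterS3 close Bcont Y_continuous => w Hw Bw Yw.
apply: (bridge_path_continuous T_gt0 alpha_gt0 Bw Yw (Y_T w)) => q qT.
have := Hw (pickle q); rewrite /rat_of pickleK /= => /(_ qT); exact.
Qed.
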